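(* Let $\mathfrak T\subset\mathbb C_0\times\mathbb X\times\mathbb P^5(\mathbb R)\times(\mathbb R/\pi)^3$ be the set of labeled, oriented, possibly-degenerate triangles. Let $\widetilde H$ be the strict transform of $H$ (regarded as the subvariety $\mathbb C_0\times H$ of $\mathbb C_0\times\mathbb X$) in the real blowup $\mathrm{Bl}_{\mathbf 0}(\mathbb C_0\times\mathbb X)$ of $\mathbb C_0\times\mathbb X$ at the origin $\mathbf 0\in\mathbb X$ (that is, along $\mathbb C_0\times\{\mathbf 0\}$). Then $$\mathrm{Bl}_{\widetilde H}\bigl(\mathrm{Bl}_{\mathbf 0}(\mathbb C_0\times\mathbb X)\bigr)=\mathfrak T$$ as subsets of $\mathbb C_0\times\mathbb X\times\mathbb P^5(\mathbb R)\times(\mathbb R/\pi)^3$, and this is a smooth $\mathbb R$-variety.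
   Context: $\mathbb C_0$ is a copy of $\mathbb C$. $\mathbb X=\{(a,b,c)\in\mathbb C^3: a+b+c=0\}$, viewed as a real variety. $H=H_a\cup H_b\cup H_c\subset\mathbb X$, where $H_a=\{a=0\}$, $H_b=\{b=0\}$, $H_c=\{c=0\}$ inside $\mathbb X$. $\mathbb R/\pi$ means $\mathbb R/\pi\mathbb Z$; it is identified with $\mathbb P^1(\mathbb R)$ (hence is an $\mathbb R$-variety) via $\rho:[x,y]\mapsto \mathrm{Arg}(x+yi)\bmod\pi$. The set $\mathfrak T$ of labeled, oriented, possibly-degenerate triangles consists of all $$(B_0;(a,b,c);[a_1,a_2,b_1,b_2,c_1,c_2];(\xi_a,\xi_b,\xi_c))\in\mathbb C_0\times\mathbb X\times\mathbb P^5(\mathbb R)\times(\mathbb R/\pi)^3$$ such that: (i) if $(a,b,c)\ne(0,0,0)$ then $[a_1,a_2,b_1,b_2,c_1,c_2]=[\mathrm{Re}\,a,\mathrm{Im}\,a,\mathrm{Re}\,b,\mathrm{Im}\,b,\mathrm{Re}\,c,\mathrm{Im}\,c]$; (ii) if $(a,b,c)=(0,0,0)$ then $a_1+b_1+c_1=a_2+b_2+c_2=0$; (iii) if $a_1+a_2i\neq0$ then $\xi_a=\mathrm{Arg}(a_1+a_2i)\bmod\pi$, and similarly for $\xi_b$ (with $b_1+b_2i$) and $\xi_c$ (with $c_1+c_2i$); (iv) if $a_1+a_2i=0$ then $\xi_a\in\mathbb R/\pi$ is arbitrary, and similarly for $\xi_b,\xi_c$. Blowups are real blowups, realized as closures of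 graphs. $\mathrm{Bl}_{\mathbf 0}(\mathbb C_0\times\mathbb X)$ is the closure in $\mathbb C_0\times\mathbb X\times\mathbb P^5(\mathbb R)$ of the graph of $(B_0;(a,b,c))\mapsto[\mathrm{Re}\,a,\mathrm{Im}\,a,\mathrm{Re}\,b,\mathrm{Im}\,b,\mathrm{Re}\,c,\mathrm{Im}\,c]$, defined off $\mathbb C_0\times\{\mathbf 0\}$. The blowup along $\widetilde H$ is the closure in $\mathbb C_0\times\mathbb X\times\mathbb P^5(\mathbb R)\times(\mathbb R/\pi)^3$ of the graph of the map sending a point of $\mathrm{Bl}_{\mathbf 0}(\mathbb C_0\times\mathbb X)\setminus\widetilde H$ with $\mathbb P^5(\mathbb R)$-component $[a_1,\dots,c_2]$ to $(\rho[a_1,a_2],\rho[b_1,b_2],\rho[c_1,c_2])$. This is the blowup of the ideal generated by the products of one coordinate from each of the pairs $(a_1,a_2),(b_1,b_2),(c_1,c_2)$, using the Segre embedding $\mathbb P^1(\mathbb R)^3\hookrightarrow\mathbb P^7(\mathbb R)$ and $\rho$. Smooth $\mathbb R$-varieties include nonsingular affine and projective varieties over $\mathbb R$ and their blowups, considered through their real points, which are naturally smooth manifolds. *)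

(* Defs.v *)
From HB Require Import structures.
From mathcomp Require Import all_boot all_order all_algebra.
From mathcomp Require Import all_classical all_reals all_analysis.
From mathcomp Require Import complex.
(* [mpoly] is not imported: its notations clash with MathComp-Analysis. *)
From mathcomp Require mpoly.

Set Implicit Arguments.
Unset Strict Implicit.
Unset Printing Implicit Defensive.

Import Order.TTheory GRing.Theory Num.Theory.
Import numFieldNormedType.Exports.

Local Open Scope classical_set_scope.
Local Open Scope ring_scope.
Local Open Scope complex_scope.
Local Open Scope quotient_scope.

(* R[i]^o rather than R[i]: only the former carries the norm topology. *)
Notation Cplx R := (R[i]^o).

Section ProjectiveSpace.
Variables (R : realType) (n : nat).

Definition nonzero : set 'rV[R]_n.+1 := [set v | v <> 0].

Definition proj_rel (u v : nonzero) : bool :=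
  `[< exists2 k : R, k != 0 & set_val v = k *: set_val u >].

Lemma proj_rel_refl : reflexive proj_rel.
Proof. by move=> u; apply/asboolP; exists 1; rewrite ?oner_eq0// scale1r. Qed.

Lemma proj_rel_sym : symmetric proj_rel.
Proof.
suff H u v : proj_rel u v -> proj_rel v u by move=> u v; apply/idP/idP; exact: H.
move=> /asboolP[k k0 E]; apply/asboolP; exists k^-1; first by rewrite invr_eq0.
by rewrite E scalerA mulVf// scale1r.
Qed.

Lemma proj_rel_trans : transitive proj_rel.
Proof.
move=> v u w /asboolP[k k0 E] /asboolP[l l0 F]; apply/asboolP.
by exists (l * k); rewrite ?mulf_neq0// F E scalerA.
Qed.

Canonical proj_equiv :=
  EquivRel proj_rel proj_rel_refl proj_rel_sym proj_rel_trans.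

Definition projective_space := quotient_topology {eq_quot proj_equiv}.

Lemma const1_nonzero : const_mx 1 \in nonzero.
Proof.
by rewrite inE => /matrixP/(_ 0 0); rewrite !mxE => /eqP; rewrite oner_eq0.
Qed.

(* The point [v_0 : ... : v_n]; the value at v = 0 is irrelevant. *)
Definition proj_pt (v : 'rV[R]_n.+1) : projective_space :=
  \pi_projective_space (insubd (SigSub const1_nonzero : nonzero) v).

Definition hom_coord (q : projective_space) : 'rV[R]_n.+1 := set_val (repr q).

End ProjectiveSpace.

Section RealsModPi.
Variable R : realType.

Definition modpi_rel (x y : R) : bool :=
  `[< exists k : int, y = x + k%:~R * pi >].

Lemma modpi_rel_refl : reflexive modpi_rel.
Proof. by move=> x; apply/asboolP; exists 0; rewrite mul0r addr0. Qed.

Lemma modpi_rel_sym : symmetric modpi_rel.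
Proof.
suff H x y : modpi_rel x y -> modpi_rel y x by move=> x y; apply/idP/idP; exact: H.
move=> /asboolP[k ->]; apply/asboolP; exists (- k).
by rewrite rmorphN mulNr addrK.
Qed.

Lemma modpi_rel_trans : transitive modpi_rel.
Proof.
move=> y x z /asboolP[k ->] /asboolP[l ->]; apply/asboolP; exists (k + l).
by rewrite rmorphD mulrDl addrA.
Qed.

Canonical modpi_equiv :=
  EquivRel modpi_rel modpi_rel_refl modpi_rel_sym modpi_rel_trans.

Definition Rmodpi := quotient_topology {eq_quot modpi_equiv}.

Definition modpi (x : R) : Rmodpi := \pi_Rmodpi x.

(* The principal argument, in ]-pi, pi]; the value at z = 0 is irrelevant. *)
Definition Arg (z : R[i]) : R :=
  let t := acos (complex.Re z / ComplexField.Normc.normc z) in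
  if 0 <= complex.Im z then t else - t.

(* Independent of the representative: Arg (k z) = Arg z mod pi for real k <> 0. *)
Definition rho (q : projective_space R 1) : Rmodpi :=
  let v := hom_coord q in modpi (Arg (v 0 0 +i* v 0 1)).

End RealsModPi.

Section Triangles.
Variable R : realType.
Notation C := (Cplx R).
Notation P n := (projective_space R n).

Definition Xset : set (C * C * C) := [set x | x.1.1 + x.1.2 + x.2 = 0].
Definition X : topologicalType := Xset.

Definition side_a (x : X) : C := (set_val x).1.1.
Definition side_b (x : X) : C := (set_val x).1.2.
Definition side_c (x : X) : C := (set_val x).2.

Definition X0 : set X := [set x | set_val x = 0].

Definition Hset : set X :=
  [set x | side_a x = 0] `|` [set x | side_b x = 0] `|` [set x | side_c x = 0].

Definition Ccoord (z : C) : 'rV[R]_2 :=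
  \row_(j < 2) [:: complex.Re z; complex.Im z]`_j.

Definition Xcoord (x : X) : 'rV[R]_6 :=
  \row_(j < 6) [:: complex.Re (side_a x); complex.Im (side_a x);
                   complex.Re (side_b x); complex.Im (side_b x);
                   complex.Re (side_c x); complex.Im (side_c x)]`_j.

(* a_1 + a_2 i, b_1 + b_2 i and c_1 + c_2 i for v = (a_1,a_2,b_1,b_2,c_1,c_2) *)
Definition part_a (v : 'rV[R]_6) : C := v 0 0 +i* v 0 1.
Definition part_b (v : 'rV[R]_6) : C := v 0 2 +i* v 0 3.
Definition part_c (v : 'rV[R]_6) : C := v 0 4 +i* v 0 5.

Definition ambient : topologicalType :=
  (C * X * P 5 * (Rmodpi R * Rmodpi R * Rmodpi R))%type.

Definition triangles : set ambient :=
  [set p | let: (B0, x, q, (xia, xib, xic)) := p in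
    exists v : 'rV[R]_6,
      [/\ v <> 0, q = proj_pt v,
          ~ X0 x -> q = proj_pt (Xcoord x),
          X0 x -> v 0 0 + v 0 2 + v 0 4 = 0 /\ v 0 1 + v 0 3 + v 0 5 = 0 &
          [/\ part_a v <> 0 -> xia = modpi (Arg (part_a v)),
              part_b v <> 0 -> xib = modpi (Arg (part_b v)) &
              part_c v <> 0 -> xic = modpi (Arg (part_c v))]]].

Definition graph_closure (T U : topologicalType) (D : set T) (f : T -> U) :
  set (T * U) := closure [set p | D p.1 /\ p.2 = f p.1].

Definition Bl0 : set (C * X * P 5) :=
  graph_closure [set p : C * X | ~ X0 p.2] (fun p => proj_pt (Xcoord p.2)).

(* Closure, in the blowup, of the preimage of Z minus the centre. *)
Definition strict_transform (Z : set (C * X)) : set (C * X * P 5) :=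
  Bl0 `&` closure (Bl0 `&` [set p | Z p.1 /\ ~ X0 p.1.2]).

Definition Htilde : set (C * X * P 5) := strict_transform [set p | Hset p.2].

(* Off Htilde the three parts of v are nonzero, so the points of P^1(R) below
   are the intended ones. *)
Definition rho3 (p : C * X * P 5) : Rmodpi R * Rmodpi R * Rmodpi R :=
  let v := hom_coord p.2 in
  (rho (proj_pt (Ccoord (part_a v))),
   rho (proj_pt (Ccoord (part_b v))),
   rho (proj_pt (Ccoord (part_c v)))).

Definition BlHtilde : set ambient := graph_closure (Bl0 `\` Htilde) rho3.

End Triangles.

Arguments triangles R : clear implicits.
Arguments Bl0 R : clear implicits.
Arguments Htilde R : clear implicits.
Arguments BlHtilde R : clear implicits.

Section SmoothVarieties.
Variable R : realType.

Definition peval n (p : mpoly.mpoly n R) (x : 'rV[R]_n) : R :=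
  mpoly.meval (fun i => x 0 i) p.

Definition algebraic_set n (V : set 'rV[R]_n) : Prop :=
  exists I : set (mpoly.mpoly n R),
    V = [set x | forall p, I p -> peval p x = 0].

Definition jacobian n m (P : 'I_m -> mpoly.mpoly n R) (x : 'rV[R]_n) :
  'M[R]_(m, n) := \matrix_(i, j) peval (mpoly.mderiv j (P i)) x.

(* Nonsingularity by the Jacobian criterion: V is a real algebraic set which,
   on a Zariski neighbourhood {h <> 0} of each of its points x, is cut out by
   n - d polynomials with linearly independent differentials at x. *)
Definition nonsingular n (d : nat) (V : set 'rV[R]_n) : Prop :=
  [/\ algebraic_set V, (d <= n)%N &
    forall x, V x ->
      exists (P : 'I_(n - d) -> mpoly.mpoly n R) (h : mpoly.mpoly n R),
        [/\ peval h x <> 0,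
            (forall y, peval h y <> 0 -> V y <-> forall i, peval (P i) y = 0) &
            \rank (jacobian P x) = (n - d)%N]].

(* The part of S in the product of the standard affine charts {v_i = 1} of
   P^5(R) and {w_j = 1} of the three factors R/pi = P^1(R), identified by rho.
   Each chart {v_i = 1} is kept as a hyperplane of R^(n+1), and X as a linear
   subspace of R^6 = C^3. *)
Definition affine_part (S : set (ambient R)) (i : 'I_6) (ja jb jc : 'I_2) :
  set 'rV[R]_(2 + (6 + (6 + (2 + (2 + 2))))) :=
  [set y | exists (B0 : Cplx R) (x : X R) (v : 'rV[R]_6) (wa wb wc : 'rV[R]_2),
    [/\ S (B0, x, proj_pt v, (rho (proj_pt wa), rho (proj_pt wb), rho (proj_pt wc))),
        v 0 i = 1, [/\ wa 0 ja = 1, wb 0 jb = 1 & wc 0 jc = 1] &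
        y = row_mx (Ccoord B0) (row_mx (Xcoord x)
              (row_mx v (row_mx wa (row_mx wb wc))))]].

Definition smooth_R_variety (S : set (ambient R)) : Prop :=
  exists d : nat, forall (i : 'I_6) (ja jb jc : 'I_2),
    nonsingular d (affine_part S i ja jb jc).

End SmoothVarieties.

(* Main.v *)
From mathcomp Require Import all_boot all_order all_algebra.
From mathcomp Require Import all_classical all_reals all_analysis.
From mathcomp Require Import complex ring lra.
From mathcomp Require Import -(notations) mpoly.
Require Import Defs.

(* Put [v = (a_1,...,c_2)] and let [t_a] be an angle representing [xi_a]. For
   [v <> 0], the conditions defining a triangle amount to the equations
   "[x] is collinear to [v]", "the edges of [v] sum to zero" and
   "[sin t_a * a_1 = cos t_a * a_2]", and likewise for [b] and [c]. Multiplied by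
   suitable coordinates they become equations between continuous functions on
   the ambient space, so the set of triangles is closed and contains the blowup.
   Conversely at most one edge of [v] vanishes, so every triangle is the limit of
   [((k + e)(v + e d), [v + e d])] as [e] tends to [0], where the direction [d] has
   the prescribed angle on the vanishing edge.
   In the affine charts of R^20 the same equations form a system of 14 = 20 - 6
   polynomials whose differentials are independent at every zero. *)

Set Implicit Arguments.
Unset Strict Implicit.
Unset Printing Implicit Defensive.

Import Order.TTheory GRing.Theory Num.Theory.
Import numFieldNormedType.Exports.

Local Open Scope classical_set_scope.
Local Open Scope ring_scope.
Local Open Scope complex_scope.

(** * Sine, cosine and arguments modulo [pi] *)

Section Angles.
Variable R : realType.
Implicit Types (x y t : R) (z : R[i]).

Lemma sincosD_nat_pi x (n : nat) :
  sin (x + n%:R * pi) = (-1) ^+ n * sin x /\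
  cos (x + n%:R * pi) = (-1) ^+ n * cos x.
Proof.
elim: n => [|n [IHs IHc]]; first by rewrite mul0r addr0 !mul1r.
rewrite mulrSr mulrDl mul1r addrA sinDpi cosDpi IHs IHc exprS.
by rewrite -!mulrA !mulN1r.
Qed.

(** Sine and cosine acquire the same sign; recording [s ^+ 2 = 1] is enough to see that products of
    two of them are invariant modulo [pi]. *)
Lemma sincosD_int_pi x (k : int) :
  exists2 s : R, s ^+ 2 = 1 &
    sin (x + k%:~R * pi) = s * sin x /\ cos (x + k%:~R * pi) = s * cos x.
Proof.
case: k => n; first by exists ((-1) ^+ n); [exact: sqrr_sign|exact: sincosD_nat_pi].
(* For [k = -(n + 1)] the natural case is applied at [x + k pi], which leads back to [x]; the sign
   is its own inverse. *)
exists ((-1) ^+ n.+1); first exact: sqrr_sign.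
have [] := sincosD_nat_pi (x + (Negz n)%:~R * pi) n.+1.
rewrite NegzE mulrNz mulNr subrK => -> ->.
by rewrite !mulrA -!expr2 !sqrr_sign !mul1r.
Qed.

(** Subtracting [floor (x / pi)] multiples of [pi] brings [x] into [[0, pi[], where the sine
    vanishes only at [0]. *)
Lemma sin_eq0 x : sin x = 0 -> exists k : int, x = k%:~R * pi.
Proof.
move=> sx; have pi0 := pi_gt0 R; exists (Num.floor (x / pi)).
set k := Num.floor _.
have kle : k%:~R * pi <= x by rewrite -ler_pdivlMr//; exact: floor_le_tmp.
have klt : x < k%:~R * pi + pi.
  rewrite -[ltRHS](_ : (k + 1)%:~R * pi = _) -?ltr_pdivrMr ?floorD1_gt//.
  by rewrite intrD mulrDl mul1r.
have [//|xk] := eqVneq x (k%:~R * pi).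
have : 0 < sin (x - k%:~R * pi).
  by apply: sin_gt0_pi; rewrite subr_gt0 lt_neqAle eq_sym xk kle /= ltrBlDl.
have [s _ [+ _]] := sincosD_int_pi x (- k).
by rewrite mulrNz mulNr => ->; rewrite sx mulr0 ltxx.
Qed.

Lemma modpi_eqP x y : modpi x = modpi y <-> exists k : int, y = x + k%:~R * pi.
Proof. by split=> [/eqmodP/asboolP//|H]; apply/eqmodP/asboolP. Qed.

Lemma modpi_eq_sinB x y : modpi x = modpi y <-> sin (x - y) = 0.
Proof.
rewrite modpi_eqP; split=> [[k ->]|/sin_eq0[k E]].
  have [s _ [+ _]] := sincosD_int_pi 0 (- k).
  by rewrite sin0 mulr0 add0r mulrNz mulNr opprD addrA subrr add0r.
by exists (- k); rewrite mulrNz mulNr -E opprB addrC subrK.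
Qed.

Lemma normc_gt0 z : z <> 0 -> 0 < ComplexField.Normc.normc z.
Proof.
case: z => a b z0; rewrite /ComplexField.Normc.normc sqrtr_gt0.
rewrite lt_neqAle addr_ge0 ?sqr_ge0// andbT eq_sym paddr_eq0 ?sqr_ge0//.
by rewrite !sqrf_eq0; apply/negP => /andP[/eqP a0 /eqP b0]; apply: z0; rewrite a0 b0.
Qed.

(** For [z = a + bi] and [r = |z|], the arccosine of [a / r] has sine [|b| / r]; the sign built into
    [Arg] turns this into [b / r]. *)
Lemma Arg_polar z : z <> 0 ->
  complex.Re z = ComplexField.Normc.normc z * cos (Arg z) /\
  complex.Im z = ComplexField.Normc.normc z * sin (Arg z).
Proof.
move=> z0; have := normc_gt0 z0; case: z z0 => a b _.
rewrite /Arg /=; set r := Num.sqrt _ => r0.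
have r2 : r ^+ 2 = a ^+ 2 + b ^+ 2 by rewrite sqr_sqrtr// addr_ge0// sqr_ge0.
have ar : -1 <= a / r <= 1.
  rewrite -ler_norml normrM normfV (gtr0_norm r0) ler_pdivrMr// mul1r.
  by rewrite -sqrtr_sqr ler_wsqrtr// lerDl sqr_ge0.
have sE : r * Num.sqrt (1 - (a / r) ^+ 2) = `|b|.
  rewrite -{1}(gtr0_norm r0) -sqrtr_sqr -sqrtrM ?sqr_ge0// -sqrtr_sqr.
  congr Num.sqrt; rewrite mulrBr mulr1 -exprMn (mulrC r) divfK ?gt_eqF// r2.
  by rewrite addrC addKr.
have cE : r * cos (acos (a / r)) = a.
  by rewrite acosK ?in_itv//= (mulrC r) divfK ?gt_eqF.
case: leP => b0; first by rewrite cE sin_acos// sE ger0_norm.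
by rewrite cosN sinN cE mulrN sin_acos// sE ltr0_norm// opprK.
Qed.

(** In polar form both sides become [sin (t - Arg z) = 0]. The equation on the right avoids the
    discontinuous [Arg] and is linear in [z]. *)
Lemma modpi_ArgP z t : z <> 0 ->
  modpi t = modpi (Arg z) <-> sin t * complex.Re z = cos t * complex.Im z.
Proof.
move=> z0; have [-> ->] := Arg_polar z0; have r0 := normc_gt0 z0.
rewrite modpi_eq_sinB sinB; set r := ComplexField.Normc.normc z in r0 *.
split=> [E|E].
  by apply/eqP; rewrite -subr_eq0 mulrCA [X in _ - X]mulrCA -mulrBr E mulr0.
by apply: (mulfI (lt0r_neq0 r0)); rewrite mulr0 mulrBr mulrCA [X in _ - X]mulrCA E subrr.
Qed.

End Angles.

(** * Homogeneous coordinates and their rescaling *)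

Section ProjectivePoints.
Variable R : realType.

Lemma set_val_insubd (T : Type) (A : set T) (d : A) (a : T) :
  A a -> set_val (insubd d a) = a.
Proof. by move=> Aa; rewrite set_valE insubdK// unfold_in/= mem_set. Qed.

Lemma proj_pt_eqP n (u v : 'rV[R]_n.+1) : u <> 0 -> v <> 0 ->
  proj_pt u = proj_pt v <-> exists2 k : R, k != 0 & v = k *: u.
Proof.
move=> u0 v0; split=> [/eqmodP/asboolP[k k0]|[k k0 E]].
  by rewrite !set_val_insubd// => ->; exists k.
by apply/eqmodP/asboolP; exists k => //; rewrite !set_val_insubd.
Qed.

Lemma hom_coord_neq0 n (q : projective_space R n) : hom_coord q <> 0.
Proof. exact: (set_valP (repr q)). Qed.

Lemma hom_coordK n (q : projective_space R n) : proj_pt (hom_coord q) = q.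
Proof. by rewrite /proj_pt /hom_coord set_valE valKd reprK. Qed.

Lemma hom_coord_proj_pt n (v : 'rV[R]_n.+1) : v <> 0 ->
  exists2 k : R, k != 0 & hom_coord (proj_pt v) = k *: v.
Proof.
move=> v0; have /proj_pt_eqP := esym (hom_coordK (proj_pt v)).
by apply => //; exact: hom_coord_neq0.
Qed.

(** The equation of [modpi_ArgP] is homogeneous in [z], which covers both signs of [k]; a negative
    [k] shifts [Arg] by an odd multiple of [pi]. *)
Lemma modpi_Arg_scale (k a b : R) : k != 0 -> a +i* b <> 0 ->
  modpi (Arg ((k * a) +i* (k * b))) = modpi (Arg (a +i* b)).
Proof.
move=> k0 z0.
have kz0 : (k * a) +i* (k * b) <> 0.
  case=> /eqP; rewrite mulf_eq0 (negPf k0) => /eqP a0 /eqP.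
  by rewrite mulf_eq0 (negPf k0) => /eqP b0; apply: z0; rewrite a0 b0.
have /(modpi_ArgP (Arg ((k * a) +i* (k * b)))) /= [+ _] := kz0.
move=> /(_ erefl) E; apply/(modpi_ArgP _ z0) => /=.
by apply: (mulfI k0); rewrite mulrCA E mulrCA.
Qed.

Lemma row2_complex_neq0 (w : 'rV[R]_2) : w <> 0 -> w 0 0 +i* w 0 1 <> 0.
Proof.
move=> w0 [a0 b0]; apply: w0; apply/rowP => j; rewrite mxE.
by case: j => -[|[|//]] ?; [rewrite -[RHS]a0|rewrite -[RHS]b0];
  congr (w _ _); exact: val_inj.
Qed.

Lemma rho_proj_pt (w : 'rV[R]_2) : w <> 0 ->
  rho (proj_pt w) = modpi (Arg (w 0 0 +i* w 0 1)).
Proof.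
move=> w0; rewrite /rho; have [k k0 ->] := hom_coord_proj_pt w0.
by rewrite !mxE; apply: modpi_Arg_scale => //; exact: row2_complex_neq0.
Qed.

End ProjectivePoints.

(** * Continuous functions and limits on the factors of the ambient space *)

Section Continuity.
Variable R : realType.

Lemma continuous_Re : continuous (fun z : Cplx R => complex.Re z : R).
Proof.
move=> z; have FF : Filter (nbhs (z : Cplx R)) by exact: nbhs_filter.
apply/(@cvgrPdist_lt _ _ _ _ FF) => e e0; near=> y.
have : `|z - y| < e%:C.
  near: y; apply: (@cvgr_dist_lt _ _ _ (nbhs z) _ (fun y => y)) => //.
  by rewrite ltcR.
rewrite normc_def ltcR; apply: le_lt_trans.
case: (z) (y) => a b [c d] /=.
by rewrite -sqrtr_sqr ler_wsqrtr// lerDl sqr_ge0.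
Unshelve. all: by end_near. Qed.

Lemma continuous_Im : continuous (fun z : Cplx R => complex.Im z : R).
Proof.
move=> z; have FF : Filter (nbhs (z : Cplx R)) by exact: nbhs_filter.
apply/(@cvgrPdist_lt _ _ _ _ FF) => e e0; near=> y.
have : `|z - y| < e%:C.
  near: y; apply: (@cvgr_dist_lt _ _ _ (nbhs z) _ (fun y => y)) => //.
  by rewrite ltcR.
rewrite normc_def ltcR; apply: le_lt_trans.
case: (z) (y) => a b [c d] /=.
by rewrite -sqrtr_sqr ler_wsqrtr// lerDr sqr_ge0.
Unshelve. all: by end_near. Qed.

Lemma cvg_complex (T : Type) (F : set_system T) (f g : T -> R) (a b : R) :
  Filter F -> f @ F --> a -> g @ F --> b ->
  (fun x => f x +i* g x : Cplx R) @ F --> (a +i* b : Cplx R).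
Proof.
(* A radius in [Cplx R] is itself a complex number; its positivity means that it is real and
   positive. *)
move=> FF fa gb; apply/cvgrPdist_lt => -[e e']; rewrite ltcE /= => /andP[/eqP -> e0].
have e20 : 0 < e / 2 by rewrite divr_gt0.
have fe := @cvgr_dist_lt _ _ _ _ _ _ _ fa _ e20.
have ge := @cvgr_dist_lt _ _ _ _ _ _ _ gb _ e20.
near=> x; have fx : `|a - f x| < e / 2 by near: x; exact: fe.
have gx : `|b - g x| < e / 2 by near: x; exact: ge.
rewrite normc_def ltcR /=.
rewrite (le_lt_trans (y := `|a - f x| + `|b - g x|))//; last first.
  by rewrite [ltRHS]splitr ltrD.
rewrite -[leRHS]ger0_norm ?addr_ge0// -[leRHS]sqrtr_sqr ler_wsqrtr//.
rewrite [leRHS]sqrrD !real_normK ?num_real// [leRHS]addrAC lerDl.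
by rewrite mulrn_wge0// mulr_ge0.
Unshelve. all: by end_near. Qed.

(** Zero sets of continuous functions are closed; this is how equations pass from graphs to their
    closures. *)
Lemma closure_eq0 (T : topologicalType) (A : set T) (f : T -> R) :
  continuous f -> (forall a, A a -> f a = 0) -> forall p, closure A p -> f p = 0.
Proof.
move=> cf fA p Ap; have : closed [set x | f x = 0].
  by apply: (@closed_comp _ _ f [set 0]) => [x _|]; [exact: cf|exact: closed_eq].
move/closure_id => cE; have : closure [set x | f x = 0] p.
  by apply: closure_subset Ap.
by rewrite -cE.
Qed.

Section RealFunctions.
Variables (T : topologicalType).
Implicit Types f g : T -> R.

Lemma continuous_mul f g : continuous f -> continuous g ->
  continuous (fun x => f x * g x).
Proof. by move=> cf cg x; apply: cvgM; [exact: cf|exact: cg]. Qed.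

Lemma continuous_add f g : continuous f -> continuous g ->
  continuous (fun x => f x + g x).
Proof. by move=> cf cg x; apply: cvgD; [exact: cf|exact: cg]. Qed.

Lemma continuous_sub f g : continuous f -> continuous g ->
  continuous (fun x => f x - g x).
Proof. by move=> cf cg x; apply: cvgB; [exact: cf|exact: cg]. Qed.

Lemma continuous_inv f : (forall x, f x != 0) -> continuous f ->
  continuous (fun x => (f x)^-1).
Proof. by move=> f0 cf x; apply: cvgV => //; exact: cf. Qed.

Lemma continuous_sum n (f : 'I_n -> T -> R) : (forall i, continuous (f i)) ->
  continuous (fun x => \sum_i f i x).
Proof.
elim: n f => [|n IHn] f cf.
  by under eq_fun do rewrite big_ord0; move=> x; exact: cvg_cst.
under eq_fun do rewrite big_ord_recl.
by apply: continuous_add => //; exact: IHn.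
Qed.

End RealFunctions.

Lemma continuous_set_val (T : topologicalType) (A : set T) :
  continuous (set_val : A -> T).
Proof. exact: initial_continuous. Qed.

Lemma cvg_set_val (U : Type) (F : set_system U) (T : topologicalType) (A : set T)
  (f : U -> A) (a : A) : Filter F ->
  set_val \o f @ F --> (set_val a : T) -> f @ F --> a.
Proof.
move=> FF fa B [_ [[C oC <-] Ca CB]]; rewrite /= nbhs_filterE.
have : nbhs (set_val a : T) C by apply: open_nbhs_nbhs.
move=> /fa; rewrite !nbhs_filterE.
by apply: (@filterS _ F FF) => x /= Cx; exact: CB.
Qed.

Definition sqnorm n (v : 'rV[R]_n) : R := \sum_l v 0 l ^+ 2.

Lemma sqnorm_neq0 n (v : 'rV[R]_n) : v <> 0 -> sqnorm v != 0.
Proof.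
move=> v0; apply/eqP => /psumr_eq0P s0; apply: v0; apply/rowP => j; rewrite mxE.
by apply/eqP; rewrite -sqrf_eq0 s0// => i _; exact: sqr_ge0.
Qed.

Lemma sqnormZ n (c : R) (v : 'rV[R]_n) : sqnorm (c *: v) = c ^+ 2 * sqnorm v.
Proof. by rewrite /sqnorm mulr_sumr; apply: eq_bigr => l _; rewrite mxE exprMn. Qed.

(* [v_j v_k / |v|^2] does not depend on the representative [v], whence a
   continuous function on projective space: bilinear equations in [v] and in
   other coordinates define closed conditions once multiplied by the [v_l]. *)
Definition proj_prod n (j k : 'I_n.+1) (q : projective_space R n) : R :=
  let v := hom_coord q in v 0 j * v 0 k / sqnorm v.

Lemma continuous_proj_prod n (j k : 'I_n.+1) : continuous (@proj_prod n j k).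
Proof.
pose g (u : @nonzero R n) := (set_val u) 0 j * (set_val u) 0 k / sqnorm (set_val u).
apply: (@repr_comp_continuous _ _ _ g).
  have cv l : continuous (fun u : @nonzero R n => (set_val u) 0 l).
    move=> u; apply: (@continuous_comp _ _ _ set_val (fun M : 'rV[R]_n.+1 => M 0 l)).
      exact: continuous_set_val.
    exact: coord_continuous.
  apply: continuous_mul; first by apply: continuous_mul; exact: cv.
  apply: continuous_inv; first by move=> u; apply: sqnorm_neq0; exact: (set_valP u).
  by apply: continuous_sum => l; apply: continuous_mul; exact: cv.
move=> u w /eqP /eqmodP/asboolP[c c0 E]; rewrite /g E sqnormZ !mxE.
have s0 : sqnorm (set_val u) != 0 by apply: sqnorm_neq0; exact: (set_valP u).
by apply/eqP; field; rewrite s0.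
Qed.

(** Sine and cosine change sign under [t + pi], so products of two of them are used: these descend
    to [Rmodpi R]. *)
Definition sin_cos (xi : Rmodpi R) : R := sin (repr xi) * cos (repr xi).
Definition sin_sin (xi : Rmodpi R) : R := sin (repr xi) * sin (repr xi).
Definition cos_cos (xi : Rmodpi R) : R := cos (repr xi) * cos (repr xi).

Lemma modpi_sincos (t u : R) : modpi t = modpi u ->
  exists2 s : R, s ^+ 2 = 1 & sin u = s * sin t /\ cos u = s * cos t.
Proof. by move=> /modpi_eqP[k ->]; exact: sincosD_int_pi. Qed.

Lemma continuous_sin_cos : continuous sin_cos.
Proof.
apply: (@repr_comp_continuous _ _ _ (fun t : R => sin t * cos t)).
  by apply: continuous_mul; [exact: continuous_sin|exact: continuous_cos].
move=> t u /eqP/modpi_sincos[s s2 [-> ->]]; apply/eqP.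
by rewrite mulrACA -[s * s]expr2 s2 mul1r.
Qed.

Lemma continuous_sin_sin : continuous sin_sin.
Proof.
apply: (@repr_comp_continuous _ _ _ (fun t : R => sin t * sin t)).
  by apply: continuous_mul; exact: continuous_sin.
move=> t u /eqP/modpi_sincos[s s2 [-> _]]; apply/eqP.
by rewrite mulrACA -[s * s]expr2 s2 mul1r.
Qed.

Lemma continuous_cos_cos : continuous cos_cos.
Proof.
apply: (@repr_comp_continuous _ _ _ (fun t : R => cos t * cos t)).
  by apply: continuous_mul; exact: continuous_cos.
move=> t u /eqP/modpi_sincos[s s2 [_ ->]]; apply/eqP.
by rewrite mulrACA -[s * s]expr2 s2 mul1r.
Qed.

Lemma continuous_modpi : continuous (@modpi R).
Proof. exact: pi_continuous. Qed.

(** On nonzero vectors [proj_pt] is the continuous quotient map; its default value at the zero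
    vector is avoided along [F]. *)
Lemma cvg_proj_pt n (T : Type) (F : set_system T) (f : T -> 'rV[R]_n.+1)
  (v : 'rV[R]_n.+1) :
  Filter F -> f @ F --> v -> v <> 0 -> (\forall x \near F, f x <> 0) ->
  (fun x => proj_pt (f x)) @ F --> proj_pt v.
Proof.
move=> FF fv v0 f0.
pose ins w : @nonzero R n := insubd (SigSub (const1_nonzero R n)) w.
suff : ins \o f @ F --> ins v.
  by move=> cins; apply: (cvg_comp _ _ cins); exact: pi_continuous.
apply: cvg_set_val; rewrite /ins set_val_insubd//; apply: cvg_trans fv.
by apply: near_eq_cvg; apply: filterS f0 => x fx0; rewrite /= set_val_insubd.
Qed.

End Continuity.

(** * Triangles as solutions of equations *)

Section Equations.
Variable R : realType.
Implicit Types (v : 'rV[R]_6) (t : R) (z : Cplx R).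

(** Vanishing of the 2 by 2 minors. It allows [u = 0], so triangles with [x = 0] obey the same
    equation as the others. *)
Definition collinear n (u v : 'rV[R]_n) : Prop :=
  forall j k, u 0 j * v 0 k = u 0 k * v 0 j.

Definition zero_sum v : Prop :=
  v 0 0 + v 0 2 + v 0 4 = 0 /\ v 0 1 + v 0 3 + v 0 5 = 0.

(** [z] is a real multiple of [exp (i t)]. For [z = 0] every [t] qualifies, as the angle of a
    vanishing edge is arbitrary. *)
Definition direction t z : Prop := sin t * complex.Re z = cos t * complex.Im z.

Lemma collinear_scale n (u v : 'rV[R]_n) : v <> 0 ->
  collinear u v <-> exists t : R, u = t *: v.
Proof.
move=> v0; split=> [uv|[t ->] j k]; last by rewrite !mxE -!mulrA (mulrC (v 0 j)).
have [[k vk]|v00] := pselect (exists k, v 0 k != 0); last first.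
  case: v0; apply/rowP => j; rewrite mxE; apply/eqP/negPn/negP => vj.
  by apply: v00; exists j.
(* Any nonzero coordinate of [v] serves as a pivot and determines the scalar. *)
exists (u 0 k / v 0 k); apply/rowP => j; rewrite mxE.
by apply: (mulIf vk); rewrite mulrAC divfK.
Qed.

Lemma zero_sumZ (k : R) v : zero_sum v -> zero_sum (k *: v).
Proof. by move=> [e1 e2]; split; rewrite !mxE -!mulrDr ?e1 ?e2 mulr0. Qed.

Lemma part_aZ (k : R) v : part_a (k *: v) = (k * v 0 0) +i* (k * v 0 1).
Proof. by rewrite /part_a !mxE. Qed.
Lemma part_bZ (k : R) v : part_b (k *: v) = (k * v 0 2) +i* (k * v 0 3).
Proof. by rewrite /part_b !mxE. Qed.
Lemma part_cZ (k : R) v : part_c (k *: v) = (k * v 0 4) +i* (k * v 0 5).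
Proof. by rewrite /part_c !mxE. Qed.

Definition partZ := (part_aZ, part_bZ, part_cZ).

Lemma directionZ t (k a b : R) :
  direction t (a +i* b) -> direction t ((k * a) +i* (k * b)).
Proof. by rewrite /direction /= => E; rewrite mulrCA E mulrCA. Qed.

Lemma directionP t z :
  direction t z <-> (z <> 0 -> modpi t = modpi (Arg z)).
Proof.
split=> [tz z0|]; first exact/modpi_ArgP.
have [->|/eqP z0] := eqVneq z 0; first by rewrite /direction /= !mulr0.
by move=> /(_ z0) /modpi_ArgP; apply.
Qed.

Lemma Xcoord_zero_sum (x : X R) : zero_sum (Xcoord x).
Proof.
have : Xset (set_val x) := set_valP x.
rewrite /Xset /= /zero_sum !mxE /= /side_a /side_b /side_c.
by case: (set_val x) => [[[a1 a2] [b1 b2]] [c1 c2]] /= [-> ->].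
Qed.

Lemma Xcoord_eq0 (x : X R) : Xcoord x = 0 <-> X0 x.
Proof.
rewrite /X0 /=; split=> [/rowP E|E]; last first.
  apply/rowP => j; rewrite !mxE /side_a /side_b /side_c E /=.
  by case: j => -[|[|[|[|[|[|//]]]]]].
have := (E 0, E 1, E 2, E 3, E 4, E 5); rewrite !mxE /= /side_a /side_b /side_c.
by case: (set_val x) => [[[a1 a2] [b1 b2]] [c1 c2]] /= [[[[[-> ->] ->] ->] ->] ->].
Qed.

(** The case distinctions disappear: [collinear] absorbs the one on [x], [direction] the one on each
    edge. All equations are homogeneous in [v], so the representative does not matter. *)
Lemma trianglesP (B0 : Cplx R) (x : X R) v (ta tb tc : R) : v <> 0 ->
  triangles R (B0, x, proj_pt v, (modpi ta, modpi tb, modpi tc)) <->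
  [/\ collinear (Xcoord x) v, zero_sum v, direction ta (part_a v),
      direction tb (part_b v) & direction tc (part_c v)].
Proof.
move=> v0; split=> [[v' [v'0 /(proj_pt_eqP v0 v'0)[k k0 E] qx x0 [ea eb ec]]]|].
  have vE : v = k^-1 *: v' by rewrite E scalerA mulVf// scale1r.
  rewrite vE !partZ; split.
  - have [/Xcoord_eq0 ->|/[dup] xn0 /qx] := pselect (X0 x).
      by move=> i j; rewrite !mxE !mul0r.
    move/proj_pt_eqP => []//; first by move/Xcoord_eq0.
    by rewrite -vE => l l0 ->; apply/collinear_scale => //; exists l.
  (* For [x <> 0] the sum condition is not part of the definition; it holds since [v'] is then a
     multiple of the sides of [x]. *)
  - apply: zero_sumZ; have [/x0//|/[dup] xn0 /qx] := pselect (X0 x).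
    move/proj_pt_eqP => []//; first by move/Xcoord_eq0.
    move=> l l0 xE; have -> : v' = (k * l^-1) *: Xcoord x.
      by rewrite xE scalerA divfK.
    by apply: zero_sumZ; exact: Xcoord_zero_sum.
  - exact/directionZ/directionP.
  - exact/directionZ/directionP.
  - exact/directionZ/directionP.
move=> [/(collinear_scale _ v0)[t xE] sv /directionP da /directionP db /directionP dc].
exists v; split=> // xn0; apply/proj_pt_eqP => //; first by move/Xcoord_eq0.
exists t => //; apply/eqP => t0; apply/xn0/Xcoord_eq0.
by rewrite xE t0 scale0r.
Qed.

Lemma modpi_repr (xi : Rmodpi R) : modpi (repr xi) = xi.
Proof. exact: reprK. Qed.

Lemma trianglesE (B0 : Cplx R) (x : X R) q (xa xb xc : Rmodpi R) :
  let v := hom_coord q in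
  triangles R (B0, x, q, (xa, xb, xc)) <->
  [/\ collinear (Xcoord x) v, zero_sum v, direction (repr xa) (part_a v),
      direction (repr xb) (part_b v) & direction (repr xc) (part_c v)].
Proof.
move=> v; rewrite -(@trianglesP B0 x v _ _ _ (@hom_coord_neq0 _ _ q)).
by rewrite hom_coordK !modpi_repr.
Qed.

Lemma continuous_Xcoord j : continuous (fun x : X R => Xcoord x 0 j).
Proof.
have ca : continuous (@side_a R).
  move=> x; apply: (@continuous_comp _ _ _ set_val
    (fun y : Cplx R * Cplx R * Cplx R => y.1.1)).
    exact: continuous_set_val.
  apply: (@continuous_comp _ _ _ fst fst); exact: cvg_fst.
have cb : continuous (@side_b R).
  move=> x; apply: (@continuous_comp _ _ _ set_val
    (fun y : Cplx R * Cplx R * Cplx R => y.1.2)).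
    exact: continuous_set_val.
  apply: (@continuous_comp _ _ _ fst snd); [exact: cvg_fst|exact: cvg_snd].
have cc : continuous (@side_c R).
  move=> x; apply: (@continuous_comp _ _ _ set_val snd).
    exact: continuous_set_val.
  exact: cvg_snd.
have cR (f : X R -> Cplx R) : continuous f -> continuous (fun x => complex.Re (f x) : R).
  by move=> cf x; apply: (@continuous_comp _ _ _ f); [exact: cf|exact: continuous_Re].
have cI (f : X R -> Cplx R) : continuous f -> continuous (fun x => complex.Im (f x) : R).
  by move=> cf x; apply: (@continuous_comp _ _ _ f); [exact: cf|exact: continuous_Im].
under eq_fun do rewrite mxE.
by case: j => -[|[|[|[|[|[|//]]]]]] ? /=; do ?[exact: cR|exact: cI].
Qed.

End Equations.

(** * The blowup consists of triangles *)

Section Closure.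
Variable R : realType.
Notation C := (Cplx R).
Notation P5 := (projective_space R 5).

Lemma continuous_pr1 (T U : topologicalType) (f : T -> R) :
  continuous f -> continuous (fun p : T * U => f p.1).
Proof.
move=> cf p; apply: (@continuous_comp _ _ _ fst f); [exact: cvg_fst|exact: cf].
Qed.

Lemma continuous_pr2 (T U : topologicalType) (f : U -> R) :
  continuous f -> continuous (fun p : T * U => f p.2).
Proof.
move=> cf p; apply: (@continuous_comp _ _ _ snd f); [exact: cvg_snd|exact: cf].
Qed.

Lemma hom_coord_cancel (q : P5) (a : R) :
  (forall l, a * hom_coord q 0 l = 0) -> a = 0.
Proof.
move=> a0; apply/eqP; apply/negPn/negP => an0; apply: (@hom_coord_neq0 _ _ q).
apply/rowP => l; rewrite mxE; apply: (mulfI an0); by rewrite a0 mulr0.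
Qed.

(** On the graph, [hom_coord] is a multiple of the sides, so both conditions hold there. They are
    linear in [v]; multiplied by [v_l / |v|^2] they become continuous, pass to the closure, and
    [hom_coord_cancel] removes the factor. *)
Lemma Bl0_equations (B0 : C) (x : X R) (q : P5) : Bl0 R (B0, x, q) ->
  collinear (Xcoord x) (hom_coord q) /\ zero_sum (hom_coord q).
Proof.
move=> Bp.
have graphE (p : C * X R * P5) : ~ X0 p.1.2 /\ p.2 = proj_pt (Xcoord p.1.2) ->
    exists2 k : R, k != 0 & hom_coord p.2 = k *: Xcoord p.1.2.
  by move=> [p0 ->]; apply: hom_coord_proj_pt => /Xcoord_eq0.
have s0 := sqnorm_neq0 (@hom_coord_neq0 _ _ q).
have cX j : continuous (fun p : C * X R * P5 => Xcoord p.1.2 0 j).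
  apply: (@continuous_pr1 _ _ (fun r : C * X R => Xcoord r.2 0 j)).
  exact: (@continuous_pr2 _ _ (fun y => Xcoord y 0 j) (@continuous_Xcoord R j)).
have cP j k : continuous (fun p : C * X R * P5 => proj_prod j k p.2).
  exact: (@continuous_pr2 _ _ (proj_prod j k) (@continuous_proj_prod R 5 j k)).
have s0V : (sqnorm (hom_coord q))^-1 != 0 by rewrite invr_eq0.
split.
  move=> j k; apply/eqP; rewrite -subr_eq0; apply/eqP/(@hom_coord_cancel q) => l.
  apply: (mulIf s0V); rewrite mul0r.
  pose f (p : C * X R * P5) :=
    Xcoord p.1.2 0 j * proj_prod k l p.2 - Xcoord p.1.2 0 k * proj_prod j l p.2.
  rewrite -[RHS](_ : f (B0, x, q) = 0); first by rewrite /f /proj_prod /=; ring.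
  apply: (@closure_eq0 _ _ _ f _ _ _ Bp).
    by apply: continuous_sub; exact: continuous_mul.
  move=> p /graphE[c c0 E]; rewrite /f /proj_prod E !mxE; ring.
have sumE (j1 j2 j3 : 'I_6) :
    (forall y : X R, Xcoord y 0 j1 + Xcoord y 0 j2 + Xcoord y 0 j3 = 0) ->
    hom_coord q 0 j1 + hom_coord q 0 j2 + hom_coord q 0 j3 = 0.
  move=> sy; apply/(@hom_coord_cancel q) => l.
  apply: (mulIf s0V); rewrite mul0r.
  pose f (p : C * X R * P5) :=
    proj_prod j1 l p.2 + proj_prod j2 l p.2 + proj_prod j3 l p.2.
  rewrite -[RHS](_ : f (B0, x, q) = 0); first by rewrite /f /proj_prod /=; ring.
  apply: (@closure_eq0 _ _ _ f _ _ _ Bp).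
    by apply: continuous_add => //; exact: continuous_add.
  move=> p /graphE[c c0 E].
  have cE i : hom_coord p.2 0 i = c * Xcoord p.1.2 0 i by rewrite E mxE.
  rewrite /f /proj_prod !cE.
  rewrite -!mulrDl -!mulrDr sy; ring.
by split; apply: sumE => y; have [] := Xcoord_zero_sum y.
Qed.

(** A nonzero edge gets its own argument from [rho]; a vanishing one has every direction, so the
    default value of [proj_pt] does no harm. *)
Lemma rho3_direction (p : C * X R * P5) (v := hom_coord p.2) :
  [/\ direction (repr (rho3 p).1.1) (part_a v),
      direction (repr (rho3 p).1.2) (part_b v) &
      direction (repr (rho3 p).2) (part_c v)].
Proof.
have cE (z : C) : z <> 0 -> direction (repr (rho (proj_pt (Ccoord z)))) z.
  move=> z0; apply/directionP => _; rewrite modpi_repr rho_proj_pt; last first.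
    move/rowP => E; apply: z0; move: (E 0) (E 1); rewrite !mxE /= {E}.
    by case: z => ? ? /= -> ->.
  by rewrite !mxE /=; case: z z0.
by split; apply/directionP => z0; apply: (directionP _ _).1 (z0); exact: cE.
Qed.

(** The equation of an edge is not a function on the ambient space, because [v] and [t] are chosen
    representatives. Its multiples by [v_l cos t / |v|^2] and [v_l sin t / |v|^2] are, and they are
    continuous. *)
Lemma direction_closed (A : set (ambient R)) (pr : ambient R -> Rmodpi R)
    (j1 j2 : 'I_6) :
  (forall F : Rmodpi R -> R, continuous F -> continuous (F \o pr)) ->
  (forall p, A p ->
    direction (repr (pr p)) (hom_coord p.1.2 0 j1 +i* hom_coord p.1.2 0 j2)) ->
  forall p, closure A p ->
    direction (repr (pr p)) (hom_coord p.1.2 0 j1 +i* hom_coord p.1.2 0 j2).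
Proof.
move=> cpr dA p Ap; rewrite /direction /=; apply/eqP; rewrite -subr_eq0; apply/eqP.
have cP j k : continuous (fun p : ambient R => proj_prod j k p.1.2).
  apply: (@continuous_pr1 _ _ (fun r : C * X R * P5 => proj_prod j k r.2)).
  exact: (@continuous_pr2 _ _ (proj_prod j k) (@continuous_proj_prod R 5 j k)).
have csc := cpr _ (@continuous_sin_cos R).
have css := cpr _ (@continuous_sin_sin R).
have ccc := cpr _ (@continuous_cos_cos R).
set q := p.1.2; set v := hom_coord q; set t := repr (pr p).
apply: (@hom_coord_cancel q) => l.
have s0 : (sqnorm v)^-1 != 0.
  by rewrite invr_eq0; apply: sqnorm_neq0; exact: hom_coord_neq0.
pose f (p : ambient R) :=
  sin_cos (pr p) * proj_prod j1 l p.1.2 - cos_cos (pr p) * proj_prod j2 l p.1.2.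
pose g (p : ambient R) :=
  sin_sin (pr p) * proj_prod j1 l p.1.2 - sin_cos (pr p) * proj_prod j2 l p.1.2.
have f0 : f p = 0.
  apply: (@closure_eq0 _ _ _ f _ _ _ Ap).
    by apply: continuous_sub; exact: continuous_mul.
  move=> a /dA; rewrite /direction /= => E.
  rewrite /f /sin_cos /cos_cos /proj_prod !mulrA [X in X - _]mulrAC.
  by rewrite (mulrAC _ (cos _)) E -!mulrA; ring.
have g0 : g p = 0.
  apply: (@closure_eq0 _ _ _ g _ _ _ Ap).
    by apply: continuous_sub; exact: continuous_mul.
  move=> a /dA; rewrite /direction /= => E.
  rewrite /g /sin_cos /sin_sin /proj_prod.
  by rewrite -!mulrA (mulrA (sin _) (hom_coord _ _ _)) E; ring.
(* Since [cos^2 + sin^2 = 1], the combination [cos t * f p + sin t * g p] gives back the equation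
   without its trigonometric factor. *)
apply: (mulIf s0); rewrite mul0r -[LHS]mul1r -(cos2Dsin2 t).
rewrite -[RHS](_ : cos t * f p + sin t * g p = 0); last by rewrite f0 g0; ring.
by rewrite /f /g /sin_cos /sin_sin /cos_cos /proj_prod -/t -/q -/v; ring.
Qed.

Lemma BlHtilde_sub_triangles : BlHtilde R `<=` triangles R.
Proof.
move=> [[[B0 x] q] [[xa xb] xc]] Bp; apply/trianglesE.
have [cx sv] : collinear (Xcoord x) (hom_coord q) /\ zero_sum (hom_coord q).
  apply: (@Bl0_equations B0).
  (* The graph projects into [Bl0 R], which is closed, so its closure does too. *)
  have cl : closed ((fst : ambient R -> _) @^-1` Bl0 R).
    by apply: closed_comp => [p _|]; [exact: cvg_fst|exact: closed_closure].
  suff : ((fst : ambient R -> _) @^-1` Bl0 R) (B0, x, q, (xa, xb, xc)) by [].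
  rewrite ((closure_id _).1 cl).
  by apply: closure_subset Bp => p [[]].
have cF1 (F : Rmodpi R -> R) : continuous F ->
    continuous (fun p : ambient R => F p.2.1.1).
  move=> cF; apply: (@continuous_pr2 _ _ (fun r : Rmodpi R * Rmodpi R * Rmodpi R => F r.1.1)).
  apply: (@continuous_pr1 _ _ (fun r : Rmodpi R * Rmodpi R => F r.1)).
  exact: (@continuous_pr1 _ _ F).
have cF2 (F : Rmodpi R -> R) : continuous F ->
    continuous (fun p : ambient R => F p.2.1.2).
  move=> cF; apply: (@continuous_pr2 _ _ (fun r : Rmodpi R * Rmodpi R * Rmodpi R => F r.1.2)).
  apply: (@continuous_pr1 _ _ (fun r : Rmodpi R * Rmodpi R => F r.2)).
  exact: (@continuous_pr2 _ _ F).
have cF3 (F : Rmodpi R -> R) : continuous F ->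
    continuous (fun p : ambient R => F p.2.2).
  move=> cF; apply: (@continuous_pr2 _ _ (fun r : Rmodpi R * Rmodpi R * Rmodpi R => F r.2)).
  exact: (@continuous_pr2 _ _ F).
split=> //.
- apply: (direction_closed (pr := fun p : ambient R => p.2.1.1) _ _ Bp) => //.
  by move=> p [_ ->]; have [] := rho3_direction p.1.
- apply: (direction_closed (pr := fun p : ambient R => p.2.1.2) _ _ Bp) => //.
  by move=> p [_ ->]; have [] := rho3_direction p.1.
- apply: (direction_closed (pr := fun p : ambient R => p.2.2) _ _ Bp) => //.
  by move=> p [_ ->]; have [] := rho3_direction p.1.
Qed.

End Closure.

(** * Every triangle is a limit of points of the graph *)

Section Density.
Variable R : realType.
Notation C := (Cplx R).
Notation P5 := (projective_space R 5).

Lemma cvg_dnbhs (T : topologicalType) (f : R -> T) :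
  {for 0, continuous f} -> f @ 0^' --> f 0.
Proof. by move=> cf; apply: cvg_trans cf; apply: cvg_app; exact: nbhs_dnbhs. Qed.

Lemma cvg_affine (a b : R) : (fun e : R => a + e * b) @ 0^' --> a.
Proof.
rewrite -[X in _ --> X](_ : a + 0 * b = a); last by rewrite mul0r addr0.
apply: (@cvg_dnbhs _ (fun e : R => a + e * b)).
by apply: cvgD; [exact: cvg_cst|apply: cvgM; [exact: cvg_id|exact: cvg_cst]].
Qed.

(** If [a = 0], the only root is [e = 0], which the punctured neighbourhood excludes; otherwise
    continuity suffices. *)
Lemma near_affine_neq0 (a b : R) : (a != 0) || (b != 0) ->
  \forall e \near (0 : R)^', a + e * b != 0.
Proof.
have [->/= b0|a0 _] := eqVneq a 0; last exact: cvgr_neq0 (@cvg_affine a b) a0.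
near=> e; rewrite add0r mulf_neq0//; near: e; exact: nbhs_dnbhs_neq.
Unshelve. all: by end_near. Qed.

(* Writing [z = r e^(it)] and [d = (p + qi) e^(it)] with [r], [p], [q] real,
   [z + ed = (r + ep + eqi) e^(it)] has argument [t + atan (eq / (r + ep))]. *)
Lemma direction_path (t a b d1 d2 : R) : direction t (a +i* b) ->
  a +i* b <> 0 \/ (d1 = cos t /\ d2 = sin t) ->
  exists2 phi : R -> R, phi @ 0^' --> t &
    \forall e \near (0 : R)^', (a + e * d1) +i* (b + e * d2) <> 0 /\
      direction (phi e) ((a + e * d1) +i* (b + e * d2)).
Proof.
rewrite /direction /= => tab abd.
have cs1 := cos2Dsin2 t; rewrite !expr2 in cs1.
pose r := a * cos t + b * sin t.
pose p := d1 * cos t + d2 * sin t; pose q := d2 * cos t - d1 * sin t.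
have aE : a = r * cos t.
  apply/eqP; rewrite -subr_eq0 -[X in X - _]mulr1 -cs1; apply/eqP.
  transitivity (sin t * (sin t * a - cos t * b)); first by rewrite /r; ring.
  by rewrite tab subrr mulr0.
have bE : b = r * sin t.
  apply/eqP; rewrite -subr_eq0 -[X in X - _]mulr1 -cs1; apply/eqP.
  transitivity (cos t * (cos t * b - sin t * a)); first by rewrite /r; ring.
  by rewrite tab subrr mulr0.
have d1E : d1 = p * cos t - q * sin t.
  by rewrite -[LHS]mulr1 -cs1 /p /q; ring.
have d2E : d2 = p * sin t + q * cos t.
  by rewrite -[LHS]mulr1 -cs1 /p /q; ring.
(* If [z = 0], then [d = exp (i t)] is already aligned with the prescribed angle. *)
have r0 : (r != 0) \/ [/\ r = 0, p = 1 & q = 0].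
  case: abd => [ab0|[d1t d2t]].
    left; apply/eqP => r0; apply: ab0.
    by rewrite aE bE r0 !mul0r.
  have [r0|] := eqVneq r 0; last by left.
  by right; split => //; rewrite ?/p ?/q d1t d2t ?cs1// mulrC subrr.
exists (fun e => t + atan (e * q / (r + e * p))).
  (* For [r = 0] the denominator vanishes at [e = 0], but [q = 0] makes the angle constant; for
     [r <> 0] the formula is continuous at [0]. *)
  case: r0 => [rn0|[_ _ ->]]; last first.
    under eq_fun do rewrite mulr0 mul0r atan0 addr0.
    exact: cvg_cst.
  have E0 : t + atan (0 * q / (r + 0 * p)) = t by rewrite !mul0r atan0 addr0.
  rewrite -{2}E0; apply: (@cvg_dnbhs _ (fun e => t + atan (e * q / (r + e * p)))).
  apply: cvgD; first exact: cvg_cst.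
  apply: continuous_comp; last exact: continuous_atan.
  apply: cvgM; first by apply: cvgM; [exact: cvg_id|exact: cvg_cst].
  apply: cvgV; first by rewrite mul0r addr0.
  by apply: cvgD; [exact: cvg_cst|apply: cvgM; [exact: cvg_id|exact: cvg_cst]].
have : \forall e \near (0 : R)^', r + e * p != 0.
  apply: near_affine_neq0.
  by case: r0 => [->//|[_ -> _]]; rewrite oner_eq0 orbT.
apply: filterS => e u0.
set w := e * q / (r + e * p); have wE : w * (r + e * p) = e * q by rewrite divfK.
have Az : a + e * d1 = (r + e * p) * (cos t - w * sin t).
  by rewrite mulrBr mulrCA mulrA wE {1}aE d1E; ring.
have Bz : b + e * d2 = (r + e * p) * (sin t + w * cos t).
  by rewrite mulrDr mulrCA mulrA wE {1}bE d2E; ring.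
split.
  move=> [A0 B0]; move: u0.
  (* The component of [z + ed] along [exp (i t)] is [r + ep], which is nonzero. *)
  have -> : r + e * p = (a + e * d1) * cos t + (b + e * d2) * sin t.
    by rewrite -[LHS]mulr1 -cs1 Az Bz; ring.
  by rewrite A0 B0 !mul0r addr0 eqxx.
rewrite Az Bz sinD cosD.
have -> : sin (atan w) = w * cos (atan w).
  by rewrite -{2}(atanK w) /tan divfK// gt_eqF// cos_gt0_pihalf// atan_gtNpi2 atan_ltpi2.
ring.
Qed.

(** The third side is recomputed from the first two, so every row yields a point of [X R]; on
    zero-sum rows nothing changes. *)
Lemma Xof_subproof (u : 'rV[R]_6) :
  (part_a u, part_b u, (- u 0 0 - u 0 2) +i* (- u 0 1 - u 0 3) : C) \in @Xset R.
Proof.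
by rewrite inE /Xset /=; congr (_ +i* _); rewrite -opprD subrr.
Qed.

Definition Xof (u : 'rV[R]_6) : X R := SigSub (Xof_subproof u).

Lemma XofK (u : 'rV[R]_6) : zero_sum u -> Xcoord (Xof u) = u.
Proof.
move=> [e1 e2].
have E4 : - u 0 0 - u 0 2 = u 0 4 by rewrite -opprD -(add0r (- _)) -e1 addrC addKr.
have E5 : - u 0 1 - u 0 3 = u 0 5 by rewrite -opprD -(add0r (- _)) -e2 addrC addKr.
apply/rowP => j; rewrite mxE /side_a /side_b /side_c set_valE /= E4 E5.
by case: j => -[|[|[|[|[|[|//]]]]]] ? /=; congr (u _ _); exact: val_inj.
Qed.

Lemma Xcoord_inj : injective (@Xcoord R).
Proof.
move=> x y /rowP E; apply: val_inj; rewrite -set_valE.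
have := (E 0, E 1, E 2, E 3, E 4, E 5); rewrite !mxE /= /side_a /side_b /side_c.
case: (set_val x) => [[[? ?] [? ?]] [? ?]]; case: (set_val y) => [[[? ?] [? ?]] [? ?]] /=.
by move=> [[[[[-> ->] ->] ->] ->] ->].
Qed.

Lemma XcoordK (x : X R) : Xof (Xcoord x) = x.
Proof. by apply: Xcoord_inj; apply: XofK; exact: Xcoord_zero_sum. Qed.

Lemma cvg_Xof (T : Type) (F : set_system T) (f : T -> 'rV[R]_6) (u : 'rV[R]_6) :
  Filter F -> f @ F --> u -> (fun x => Xof (f x)) @ F --> Xof u.
Proof.
move=> FF fu; apply: cvg_set_val.
have ci j : (fun x => f x 0 j) @ F --> u 0 j.
  apply: (@cvg_comp _ _ _ f (fun M : 'rV[R]_6 => M 0 j) _ _ _ fu).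
  exact: coord_continuous.
have ca : (fun x => part_a (f x)) @ F --> part_a u by exact: cvg_complex.
have cb : (fun x => part_b (f x)) @ F --> part_b u by exact: cvg_complex.
have cc : (fun x => (- f x 0 0 - f x 0 2) +i* (- f x 0 1 - f x 0 3) : C) @ F -->
    ((- u 0 0 - u 0 2) +i* (- u 0 1 - u 0 3) : C).
  by apply: cvg_complex; apply: cvgB => //; exact: cvgN.
exact: (cvg_pair (cvg_pair ca cb) cc).
Qed.

(** The product of the squared lengths of the three sides is continuous and vanishes over [H], hence
    on [Htilde R]; here it is nonzero. *)
Lemma not_Htilde (B0 : C) (x : X R) (q : P5) :
  [/\ part_a (Xcoord x) <> 0, part_b (Xcoord x) <> 0 & part_c (Xcoord x) <> 0] ->
  ~ Htilde R (B0, x, q).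
Proof.
move=> [a0 b0 c0] [_ Hx].
pose n2 (j k : 'I_6) (x : X R) := Xcoord x 0 j ^+ 2 + Xcoord x 0 k ^+ 2.
pose f (p : C * X R * P5) := n2 0 1 p.1.2 * n2 2 3 p.1.2 * n2 4 5 p.1.2.
have n2P j k (y : X R) : Xcoord y 0 j +i* Xcoord y 0 k <> 0 -> n2 j k y != 0.
  move=> y0; rewrite /n2 paddr_eq0 ?sqr_ge0// !sqrf_eq0; apply/negP.
  by move=> /andP[/eqP yj /eqP yk]; apply: y0; rewrite yj yk.
suff : f (B0, x, q) = 0.
  by apply/eqP; rewrite /f /= !mulf_neq0//; exact: n2P.
apply: (@closure_eq0 _ _ _ f _ _ _ Hx).
  have cn j k : continuous (fun p : C * X R * P5 => n2 j k p.1.2).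
    apply: (@continuous_pr1 _ _ _ (fun r : C * X R => n2 j k r.2)).
    apply: (@continuous_pr2 _ _ _ (n2 j k)).
    by apply: continuous_add; apply: continuous_mul; exact: continuous_Xcoord.
  by apply: continuous_mul => //; exact: continuous_mul.
move=> [[B y] r] [_ [/= Hy _]]; rewrite /f /n2 /= !mxE /=.
by case: Hy => [[|]|] /= ->; rewrite /= !expr2 !mul0r addr0 ?mulr0 ?mul0r.
Qed.

(** With [k] and all edges nonzero, the point lies over a nondegenerate [x] and off [Htilde R], and
    the directions determine the angles modulo [pi]. *)
Lemma triangles_graph (B0 : C) (v : 'rV[R]_6) (k ta tb tc : R) :
  k != 0 -> zero_sum v ->
  part_a v <> 0 /\ direction ta (part_a v) ->
  part_b v <> 0 /\ direction tb (part_b v) ->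
  part_c v <> 0 /\ direction tc (part_c v) ->
  let p := (B0, Xof (k *: v), proj_pt v) in
  (Bl0 R `\` Htilde R) p /\ (modpi ta, modpi tb, modpi tc) = rho3 p.
Proof.
move=> k0 sv [a0 da] [b0 db] [c0 dc] p.
have v0 : v <> 0 by move=> vE; apply: a0; rewrite vE /part_a !mxE.
have scale_neq0 (l x y : R) : l != 0 -> x +i* y <> 0 -> (l * x) +i* (l * y) <> 0.
  move=> l0 z0 [/eqP + /eqP]; rewrite !mulf_eq0 (negPf l0) /= => /eqP xE /eqP yE.
  by apply: z0; rewrite xE yE.
have xE : Xcoord (Xof (k *: v)) = k *: v by apply: XofK; exact: zero_sumZ.
have kv0 : k *: v <> 0.
  by move/eqP; rewrite scaler_eq0 (negPf k0) => /eqP.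
split; first split.
- apply: subset_closure; split => /=; first by move/Xcoord_eq0; rewrite xE.
  by apply/proj_pt_eqP; rewrite ?xE//; exists k.
- by apply: not_Htilde; rewrite xE !partZ; split; exact: scale_neq0.
have [l l0 lE] := hom_coord_proj_pt v0.
have := rho3_direction p; case: (rho3 p) => [[xa xb] xc] /=.
rewrite lE !partZ => -[ea eb ec].
have congr_dir t xi (x y : R) : x +i* y <> 0 -> direction t (x +i* y) ->
    direction (repr xi) ((l * x) +i* (l * y)) -> modpi t = xi.
  move=> z0 tz xz; rewrite -(modpi_repr xi).
  have lz := scale_neq0 l x y l0 z0.
  by rewrite ((directionP _ _).1 xz lz) ((directionP _ _).1 (directionZ l tz) lz).
rewrite (congr_dir _ _ _ _ a0 da ea) (congr_dir _ _ _ _ b0 db eb).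
by rewrite (congr_dir _ _ _ _ c0 dc ec).
Qed.

(** Two vanishing edges would force the third to vanish. So at most one needs a prescribed
    direction, and one of the others moves oppositely to keep the sum zero. *)
Lemma generic_direction (v : 'rV[R]_6) (ta tb tc : R) : v <> 0 -> zero_sum v ->
  exists d : 'rV[R]_6, [/\ zero_sum d,
    part_a v <> 0 \/ (d 0 0 = cos ta /\ d 0 1 = sin ta),
    part_b v <> 0 \/ (d 0 2 = cos tb /\ d 0 3 = sin tb) &
    part_c v <> 0 \/ (d 0 4 = cos tc /\ d 0 5 = sin tc)].
Proof.
move=> v0 [s1 s2].
pose mk (a b c d e f : R) : 'rV[R]_6 := \row_j [:: a; b; c; d; e; f]`_j.
have rowE : ~ [/\ v 0 0 = 0 /\ v 0 1 = 0, v 0 2 = 0 /\ v 0 3 = 0 & v 0 4 = 0 /\ v 0 5 = 0].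
  move=> [[e0 e1] [e2 e3] [e4 e5]]; apply: v0; apply/rowP => j; rewrite mxE.
  case: j => -[|[|[|[|[|[|//]]]]]] jP.
  - by rewrite -[RHS]e0; congr (v _ _); exact: val_inj.
  - by rewrite -[RHS]e1; congr (v _ _); exact: val_inj.
  - by rewrite -[RHS]e2; congr (v _ _); exact: val_inj.
  - by rewrite -[RHS]e3; congr (v _ _); exact: val_inj.
  - by rewrite -[RHS]e4; congr (v _ _); exact: val_inj.
  - by rewrite -[RHS]e5; congr (v _ _); exact: val_inj.
have [[a0 a1]|a0] := pselect (part_a v = 0).
  exists (mk (cos ta) (sin ta) (- cos ta) (- sin ta) 0 0); split.
  - by split; rewrite !mxE /= subrr add0r.
  - by right; rewrite !mxE.
  - left => -[b0 b1]; apply: rowE; split => //; split.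
      by move: s1; rewrite a0 b0 !add0r.
    by move: s2; rewrite a1 b1 !add0r.
  - left => -[c0 c1]; apply: rowE; split => //; split.
      by move: s1; rewrite a0 c0 add0r addr0.
    by move: s2; rewrite a1 c1 add0r addr0.
have [[b0 b1]|b0] := pselect (part_b v = 0).
  exists (mk (- cos tb) (- sin tb) (cos tb) (sin tb) 0 0); split.
  - by split; rewrite !mxE /= addNr add0r.
  - by left.
  - by right; rewrite !mxE.
  - left => -[c0 c1]; apply: rowE; split => //; split.
      by move: s1; rewrite b0 c0 !addr0.
    by move: s2; rewrite b1 c1 !addr0.
(* With [a] and [b] nonzero, this choice serves whether or not [c] vanishes. *)
exists (mk (- cos tc) (- sin tc) 0 0 (cos tc) (sin tc)); split.
- by split; rewrite !mxE /= addr0 addNr.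
- by left.
- by left.
- by right; rewrite !mxE.
Qed.

Lemma triangles_sub_BlHtilde : triangles R `<=` BlHtilde R.
Proof.
move=> [[[B0 x] q] [[xa xb] xc]] /trianglesE.
set v := hom_coord q; set ta := repr xa; set tb := repr xb; set tc := repr xc.
have v0 : v <> 0 := @hom_coord_neq0 _ _ q.
move=> [/(collinear_scale _ v0)[k xE] sv da db dc].
have [d [sd ga gb gc]] := generic_direction ta tb tc v0 sv.
have [fa cfa nfa] := direction_path da ga.
have [fb cfb nfb] := direction_path db gb.
have [fc cfc nfc] := direction_path dc gc.
pose w (e : R) := v + e *: d.
have wE e j : w e 0 j = v 0 j + e * d 0 j by rewrite !mxE.
have cw : w @ 0^' --> v.
  rewrite -[X in _ --> X](_ : w 0 = v); last by rewrite /w scale0r addr0.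
  apply: cvg_dnbhs; apply: cvgD; first exact: cvg_cst.
  by apply: cvgZr_tmp; exact: cvg_id.
(* The factor [k + e] is nonzero for small [e <> 0] even when [k = 0], so the path leaves the centre
   of the first blowup; [d] moves it off [Htilde R]. *)
pose gam (e : R) : ambient R := (B0, Xof ((k + e * 1) *: w e), proj_pt (w e),
  (modpi (fa e), modpi (fb e), modpi (fc e))).
have gamE : \forall e \near (0 : R)^',
    [set p | (Bl0 R `\` Htilde R) p.1 /\ p.2 = rho3 p.1] (gam e).
  near=> e; apply: triangles_graph.
  - by near: e; apply: near_affine_neq0; rewrite oner_eq0 orbT.
  - have [[s1 s2] [s3 s4]] := (sv, sd).
    split; rewrite !wE; last by rewrite -[RHS](addr0 0) -{1}s2 -[in RHS](mulr0 e) -s4; ring.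
    by rewrite -[RHS](addr0 0) -{1}s1 -[in RHS](mulr0 e) -s3; ring.
  - by rewrite /part_a !wE; near: e.
  - by rewrite /part_b !wE; near: e.
  - by rewrite /part_c !wE; near: e.
have ma : (fun e => modpi (fa e)) @ 0^' --> xa.
  by rewrite -(modpi_repr xa); apply: (cvg_comp _ _ cfa); exact: continuous_modpi.
have mb : (fun e => modpi (fb e)) @ 0^' --> xb.
  by rewrite -(modpi_repr xb); apply: (cvg_comp _ _ cfb); exact: continuous_modpi.
have mc : (fun e => modpi (fc e)) @ 0^' --> xc.
  by rewrite -(modpi_repr xc); apply: (cvg_comp _ _ cfc); exact: continuous_modpi.
have mx : (fun e => Xof ((k + e * 1) *: w e)) @ 0^' --> x.
  rewrite -(XcoordK x) xE; apply: cvg_Xof; apply: cvgZ => //.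
  exact: cvg_affine.
have mq : (fun e => proj_pt (w e)) @ 0^' --> q.
  rewrite -(hom_coordK q); apply: cvg_proj_pt => //.
  apply: filterS nfa => e; rewrite -!wE => -[w0 _] E.
  by apply: w0; rewrite E !mxE.
have mB : (fun=> B0) @ (0 : R)^' --> B0 by exact: cvg_cst.
have cgam : gam @ 0^' --> (B0, x, q, (xa, xb, xc)).
  exact: (cvg_pair (cvg_pair (cvg_pair mB mx) mq) (cvg_pair (cvg_pair ma mb) mc)).
move=> B nB; have gamB : \forall e \near (0 : R)^', B (gam e) by exact: cgam.
have [e [ge Be]] :=
  @filter_ex _ _ (Proper_dnbhs_numFieldType (0 : R)) _ (filterI gamE gamB).
by exists (gam e).
Unshelve. all: by end_near. Qed.

End Density.

(** * Differentials of polynomials and the rank of the Jacobian *)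

Section JacobianCriterion.
Variables (R : realType) (n : nat).
Implicit Types (p q : mpoly n R) (x w : 'rV[R]_n).

(** The differential of [p] at [x] applied to [w]; independence can then be tested on well-chosen
    vectors [w]. *)
Definition dirderiv p x w : R := \sum_j w 0 j * peval (mderiv j p) x.

Lemma dirderivD p q x w : dirderiv (p + q) x w = dirderiv p x w + dirderiv q x w.
Proof.
rewrite /dirderiv -big_split; apply: eq_bigr => j _ /=.
by rewrite mderivD /peval mevalD mulrDr.
Qed.

Lemma dirderivB p q x w : dirderiv (p - q) x w = dirderiv p x w - dirderiv q x w.
Proof.
rewrite /dirderiv -sumrB; apply: eq_bigr => j _ /=.
by rewrite mderivB /peval mevalB mulrBr.
Qed.

Lemma dirderivM p q x w :
  dirderiv (p * q) x w = dirderiv p x w * peval q x + peval p x * dirderiv q x w.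
Proof.
rewrite /dirderiv mulr_suml mulr_sumr -big_split; apply: eq_bigr => j _ /=.
by rewrite mderivM /peval mevalD !mevalM; ring.
Qed.

Lemma dirderivC c x w : dirderiv (mpolyC n c) x w = 0.
Proof.
by rewrite /dirderiv big1// => j _; rewrite mderivC /peval meval0 mulr0.
Qed.

Lemma dirderivX k x w : dirderiv (mpolyX R (mnm1 k)) x w = w 0 k.
Proof.
rewrite /dirderiv (bigD1 k)//= big1 ?addr0; last first.
  move=> j jk; rewrite mderivX mnm1E eq_sym (negPf jk) scale0r.
  by rewrite /peval meval0 mulr0.
rewrite mderivX mnm1E eqxx scale1r /peval.
have -> : mnm_sub (mnm1 k) (mnm1 k) = mnm0 by apply/mnmP => l; rewrite mnmBE mnm0E subnn.
by rewrite mpolyX0 meval1 mulr1.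
Qed.

(** The sum is the row [u *m jacobian P x] paired with [w], so the hypothesis says that the rows are
    independent. *)
Lemma rank_jacobian m (P : 'I_m -> mpoly n R) x :
  (forall u : 'I_m -> R,
    (forall w, \sum_i u i * dirderiv (P i) x w = 0) -> forall i, u i = 0) ->
  \rank (jacobian P x) = m.
Proof.
move=> H; apply/eqP; apply: inj_row_free => u uJ; apply/rowP => i; rewrite mxE.
apply: H => w; transitivity (\sum_j w 0 j * (u *m jacobian P x) 0 j); last first.
  by rewrite uJ big1// => j _; rewrite mxE mulr0.
under eq_bigr do rewrite /dirderiv mulr_sumr.
rewrite exchange_big; apply: eq_bigr => j _ /=; rewrite mxE mulr_sumr.
by apply: eq_bigr => k _; rewrite mxE mulrCA.
Qed.

End JacobianCriterion.

(** * Equations and nonsingularity in the affine charts *)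

Section AffineCharts.
Variable R : realType.

Notation N := (2 + (6 + (6 + (2 + (2 + 2)))))%N.
Implicit Types (y : 'rV[R]_N).

Definition chart_x (j : 'I_6) : 'I_N := rshift 2 (lshift _ j).
Definition chart_v (j : 'I_6) : 'I_N := rshift 2 (rshift 6 (lshift _ j)).
Definition chart_a (j : 'I_2) : 'I_N := rshift 2 (rshift 6 (rshift 6 (lshift _ j))).
Definition chart_b (j : 'I_2) : 'I_N :=
  rshift 2 (rshift 6 (rshift 6 (rshift 2 (lshift _ j)))).
Definition chart_c (j : 'I_2) : 'I_N :=
  rshift 2 (rshift 6 (rshift 6 (rshift 2 (rshift 2 j)))).

Definition chart_pt (b : 'rV[R]_2) (x v : 'rV[R]_6) (wa wb wc : 'rV[R]_2) : 'rV[R]_N :=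
  row_mx b (row_mx x (row_mx v (row_mx wa (row_mx wb wc)))).

Lemma chart_ptE b x v wa wb wc (y := chart_pt b x v wa wb wc) :
  [/\ forall j, y 0 (chart_x j) = x 0 j, forall j, y 0 (chart_v j) = v 0 j,
      forall j, y 0 (chart_a j) = wa 0 j, forall j, y 0 (chart_b j) = wb 0 j &
      forall j, y 0 (chart_c j) = wc 0 j].
Proof. by split=> j; rewrite /y /chart_pt !(row_mxEl, row_mxEr). Qed.

Lemma chart_ptP y : exists b x v wa wb wc, y = chart_pt b x v wa wb wc.
Proof.
exists (lsubmx y), (lsubmx (rsubmx y)), (lsubmx (rsubmx (rsubmx y))),
  (lsubmx (rsubmx (rsubmx (rsubmx y)))),
  (lsubmx (rsubmx (rsubmx (rsubmx (rsubmx y))))),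
  (rsubmx (rsubmx (rsubmx (rsubmx (rsubmx y))))).
by rewrite /chart_pt !hsubmxK.
Qed.

(** Since [v_i = 1], collinearity reduces to the five equations [x_j = x_i v_j] for [j <> i]. In all
    there are 4 + 2 + 3 + 5 = 14 equations. *)
Definition chart_eqs (i : 'I_6) (ja jb jc : 'I_2) (x v : 'rV[R]_6)
    (wa wb wc : 'rV[R]_2) : Prop :=
  [/\ [/\ v 0 i = 1, wa 0 ja = 1, wb 0 jb = 1 & wc 0 jc = 1],
      zero_sum v,
      [/\ wa 0 0 * v 0 1 = wa 0 1 * v 0 0, wb 0 0 * v 0 3 = wb 0 1 * v 0 2 &
          wc 0 0 * v 0 5 = wc 0 1 * v 0 4] &
      forall j, x 0 (lift i j) = x 0 i * v 0 (lift i j)].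

(** [w] is a positive multiple of [(cos t, sin t)], so the two equations differ by a nonzero
    factor. *)
Lemma direction_Arg (w : 'rV[R]_2) (a b : R) : w <> 0 ->
  direction (Arg (w 0 0 +i* w 0 1)) (a +i* b) <-> w 0 0 * b = w 0 1 * a.
Proof.
move=> /row2_complex_neq0 w0; have := Arg_polar w0; have := normc_gt0 w0.
set r := ComplexField.Normc.normc _; set t := Arg _ => r0 [/= E0 E1].
rewrite /direction /= E0 E1 -!mulrA; split=> [->//|E].
by apply: (mulfI (lt0r_neq0 r0)); rewrite E.
Qed.

Lemma row_neq0 m (w : 'rV[R]_m) j : w 0 j = 1 -> w <> 0.
Proof. by move=> wj w0; move: wj; rewrite w0 mxE => /esym/eqP; rewrite oner_eq0. Qed.

Lemma affine_partE i ja jb jc b x v wa wb wc :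
  affine_part (triangles R) i ja jb jc (chart_pt b x v wa wb wc) <->
  chart_eqs i ja jb jc x v wa wb wc.
Proof.
split.
  move=> [B0 [x' [v' [wa' [wb' [wc' [T vi [wja wjb wjc]]]]]]]].
  move=> /eq_row_mx[_ /eq_row_mx[-> /eq_row_mx[-> /eq_row_mx[-> /eq_row_mx[-> ->]]]]].
  have [[[v0 a0] b0] c0] := (row_neq0 vi, row_neq0 wja, row_neq0 wjb, row_neq0 wjc).
  move: T; rewrite !rho_proj_pt// => /(trianglesP _ _ _ _ _ v0)[col sv].
  move=> /(direction_Arg _ _ a0) ea /(direction_Arg _ _ b0) eb /(direction_Arg _ _ c0) ec.
  by split=> // j; rewrite -col vi mulr1.
move=> [[vi wja wjb wjc] sv [ea eb ec] ex].
have [[[v0 a0] b0] c0] := (row_neq0 vi, row_neq0 wja, row_neq0 wjb, row_neq0 wjc).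
have xE : x = x 0 i *: v.
  apply/rowP => j; rewrite mxE; case: (unliftP i j) => [k|] ->; first exact: ex.
  by rewrite vi mulr1.
have sx : zero_sum x by rewrite xE; exact: zero_sumZ.
exists (b 0 0 +i* b 0 1), (Xof x), v, wa, wb, wc; split => //; last first.
  rewrite XofK// /chart_pt; congr row_mx; apply/rowP => j; rewrite mxE.
  by case: j => -[|[|//]] ? /=; congr (b _ _); exact: val_inj.
rewrite !rho_proj_pt//; apply/trianglesP => //; rewrite XofK//; split=> //.
- by apply/collinear_scale => //; exists (x 0 i).
- exact/direction_Arg.
- exact/direction_Arg.
- exact/direction_Arg.
Qed.

Notation XX k := (mpolyX R (mnm1 k)).

Definition wedge_poly (k0 k1 l0 l1 : 'I_N) : mpoly N R :=
  XX k0 * XX l1 - XX k1 * XX l0.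

Definition base_polys (i : 'I_6) (ja jb jc : 'I_2) : seq (mpoly N R) :=
  [:: XX (chart_v i) - mpolyC N 1; XX (chart_a ja) - mpolyC N 1;
      XX (chart_b jb) - mpolyC N 1; XX (chart_c jc) - mpolyC N 1;
      XX (chart_v 0) + XX (chart_v 2) + XX (chart_v 4);
      XX (chart_v 1) + XX (chart_v 3) + XX (chart_v 5);
      wedge_poly (chart_a 0) (chart_a 1) (chart_v 0) (chart_v 1);
      wedge_poly (chart_b 0) (chart_b 1) (chart_v 2) (chart_v 3);
      wedge_poly (chart_c 0) (chart_c 1) (chart_v 4) (chart_v 5)].

Definition ratio_poly (i : 'I_6) (j : 'I_5) : mpoly N R :=
  XX (chart_x (lift i j)) - XX (chart_x i) * XX (chart_v (lift i j)).

(** The index [9 + 5] separates the equations free of [x] from the ratios, and computes to the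
    codimension 20 - 6. *)
Definition chart_polys i ja jb jc (k : 'I_(9 + 5)) : mpoly N R :=
  match fintype.split k with
  | inl l => (base_polys i ja jb jc)`_l
  | inr j => ratio_poly i j
  end.

Lemma chart_polys_l i ja jb jc l :
  chart_polys i ja jb jc (lshift 5 l) = (base_polys i ja jb jc)`_l.
Proof. by rewrite /chart_polys (unsplitK (inl l)). Qed.

Lemma chart_polys_r i ja jb jc j :
  chart_polys i ja jb jc (rshift 9 j) = ratio_poly i j.
Proof. by rewrite /chart_polys (unsplitK (inr j)). Qed.

Lemma pevalX k y : peval (XX k) y = y 0 k. Proof. exact: mevalXU. Qed.
Lemma pevalC c y : peval (mpolyC N c) y = c. Proof. exact: mevalC. Qed.
Lemma pevalD (p q : mpoly N R) y : peval (p + q) y = peval p y + peval q y.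
Proof. exact: mevalD. Qed.
Lemma pevalB (p q : mpoly N R) y : peval (p - q) y = peval p y - peval q y.
Proof. exact: mevalB. Qed.
Lemma pevalM (p q : mpoly N R) y : peval (p * q) y = peval p y * peval q y.
Proof. exact: mevalM. Qed.
Definition pevalE := (pevalB, pevalD, pevalM, pevalX, pevalC).

Lemma chart_polysE i ja jb jc b x v wa wb wc :
  (forall k, peval (chart_polys i ja jb jc k) (chart_pt b x v wa wb wc) = 0) <->
  chart_eqs i ja jb jc x v wa wb wc.
Proof.
have [yx yv ya yb yc] := chart_ptE b x v wa wb wc.
split=> [H|[[vi wja wjb wjc] [s1 s2] [ea eb ec] ex] k].
  have Hl l : peval (base_polys i ja jb jc)`_l (chart_pt b x v wa wb wc) = 0.
    have [l9|l9] := ltnP l 9; last by rewrite nth_default// /peval meval0.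
    by have := H (lshift 5 (Ordinal l9)); rewrite chart_polys_l.
  split; first split.
  - by have := Hl 0%N; rewrite /= !pevalE !yv => /eqP; rewrite subr_eq0 => /eqP.
  - by have := Hl 1%N; rewrite /= !pevalE !ya => /eqP; rewrite subr_eq0 => /eqP.
  - by have := Hl 2%N; rewrite /= !pevalE !yb => /eqP; rewrite subr_eq0 => /eqP.
  - by have := Hl 3%N; rewrite /= !pevalE !yc => /eqP; rewrite subr_eq0 => /eqP.
  - split.
    + by have := Hl 4%N; rewrite /= !pevalE !yv.
    + by have := Hl 5%N; rewrite /= !pevalE !yv.
  - split.
    + by have := Hl 6%N; rewrite /= !pevalE !yv !ya => /eqP; rewrite subr_eq0 => /eqP.
    + by have := Hl 7%N; rewrite /= !pevalE !yv !yb => /eqP; rewrite subr_eq0 => /eqP.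
    + by have := Hl 8%N; rewrite /= !pevalE !yv !yc => /eqP; rewrite subr_eq0 => /eqP.
  - move=> j; have := H (rshift 9 j); rewrite chart_polys_r !pevalE !yx !yv => /eqP.
    by rewrite subr_eq0 => /eqP.
case: (split_ordP k) => [l ->|j ->]; last first.
  by rewrite chart_polys_r !pevalE !yx !yv ex subrr.
rewrite chart_polys_l.
by case: l => -[|[|[|[|[|[|[|[|[|//]]]]]]]]] ? /=;
  rewrite !pevalE ?(yv, ya, yb, yc) ?(vi, wja, wjb, wjc, s1, s2, ea, eb, ec) ?subrr.
Qed.

(** Here [u] and [k] are the multipliers of [w_j = 1] and of the incidence of [w] with the edge
    [(a, b)]. The basis vector other than [j] kills one of [k a], [k b], the incidence kills the
    other, and then [u] vanishes. *)
Lemma unit_row_cancel (w : 'rV[R]_2) (j : 'I_2) (a b u k : R) :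
  w 0 j = 1 -> w 0 0 * b = w 0 1 * a ->
  (forall d : 'rV[R]_2, u * d 0 j + k * (d 0 0 * b - d 0 1 * a) = 0) ->
  [/\ u = 0, k * a = 0 & k * b = 0].
Proof.
move=> wj wab H; move: (H (delta_mx 0 0)) (H (delta_mx 0 1)).
have [jE|jE] : j = 0 \/ j = 1.
- by case: (j) => -[|[|//]] ?; [left|right]; exact: val_inj.
- rewrite !mxE jE /= in wj wab *; rewrite wj mul1r in wab => e1 e2.
  have ka : k * a = 0 by rewrite -[LHS]opprK -[X in - X]add0r -[RHS]oppr0 -[in RHS]e2; ring.
  have kb : k * b = 0 by rewrite wab mulrCA ka mulr0.
  by split=> //; rewrite -e1 mul0r subr0 mul1r kb addr0 mulr1.
- rewrite !mxE jE /= in wj wab *; rewrite wj mul1r in wab => e1 e2.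
  have kb : k * b = 0 by rewrite -e1; ring.
  have ka : k * a = 0 by rewrite -wab mulrCA kb mulr0.
  by split=> //; rewrite -e2 mul0r sub0r mul1r mulrN ka oppr0 addr0 mulr1.
Qed.

(** If [k] or [l] is zero, then so is [(s1, s2)], and the nonzero row [wb] or [wc] forces the other
    multiplier to vanish. *)
Lemma parallel_cancel (k l s1 s2 a0 a1 b0 b1 c0 c1 : R) (wb wc : 'rV[R]_2) jb jc :
  [/\ k * b0 = 0, k * b1 = 0, l * c0 = 0 & l * c1 = 0] ->
  a0 != 0 \/ a1 != 0 -> a0 + b0 + c0 = 0 -> a1 + b1 + c1 = 0 ->
  wb 0 jb = 1 -> wc 0 jc = 1 ->
  s1 = k * wb 0 1 /\ s2 = - (k * wb 0 0) -> s1 = l * wc 0 1 /\ s2 = - (l * wc 0 0) ->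
  [/\ k = 0, l = 0, s1 = 0 & s2 = 0].
Proof.
have cancel (m : R) (w : 'rV[R]_2) j : w 0 j = 1 ->
    m * w 0 1 = 0 -> - (m * w 0 0) = 0 -> m = 0.
  move=> wj e1 /eqP; rewrite oppr_eq0 => /eqP e0; rewrite -(mulr1 m) -wj.
  by case: j wj => -[|[|//]] ? _; [rewrite -[RHS]e0|rewrite -[RHS]e1];
     congr (_ * w _ _); exact: val_inj.
move=> [kb0 kb1 lc0 lc1] a0n e0 e1 wbj wcj [s1b s2b] [s1c s2c].
have [k0|k0] := eqVneq k 0.
  rewrite k0 mul0r in s1b; rewrite k0 mul0r oppr0 in s2b; split=> //.
  by apply: (cancel l wc jc) => //; [rewrite -s1c|rewrite -s2c].
have [l0|l0] := eqVneq l 0.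
  rewrite l0 mul0r in s1c; rewrite l0 mul0r oppr0 in s2c; split=> //.
  by apply: (cancel k wb jb) => //; [rewrite -s1b|rewrite -s2b].
(* With both multipliers nonzero, the edges [b] and [c] vanish, hence also [a] by the zero sum: a
   contradiction. *)
move/eqP: kb0; rewrite mulf_eq0 (negPf k0) => /eqP b00.
move/eqP: kb1; rewrite mulf_eq0 (negPf k0) => /eqP b10.
move/eqP: lc0; rewrite mulf_eq0 (negPf l0) => /eqP c00.
move/eqP: lc1; rewrite mulf_eq0 (negPf l0) => /eqP c10.
move: e0 e1; rewrite b00 b10 c00 c10 !addr0 => e0 e1.
by case: a0n; rewrite ?e0 ?e1 eqxx.
Qed.

(* The edge that contains the coordinate [v_i = 1] is nonzero, and so is one of
   the other two edges: only one of the three incidences can degenerate. *)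
Lemma chart_cancel i ja jb jc x v wa wb wc (u s1 s2 ua ub uc ka kb kc : R) :
  chart_eqs i ja jb jc x v wa wb wc ->
  (forall (dv : 'rV[R]_6) (da db dc : 'rV[R]_2),
    u * dv 0 i + ua * da 0 ja + ub * db 0 jb + uc * dc 0 jc +
    s1 * (dv 0 0 + dv 0 2 + dv 0 4) + s2 * (dv 0 1 + dv 0 3 + dv 0 5) +
    ka * (da 0 0 * v 0 1 + wa 0 0 * dv 0 1 - (da 0 1 * v 0 0 + wa 0 1 * dv 0 0)) +
    kb * (db 0 0 * v 0 3 + wb 0 0 * dv 0 3 - (db 0 1 * v 0 2 + wb 0 1 * dv 0 2)) +
    kc * (dc 0 0 * v 0 5 + wc 0 0 * dv 0 5 - (dc 0 1 * v 0 4 + wc 0 1 * dv 0 4)) = 0) ->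
  [/\ u = 0, [/\ ua = 0, ub = 0 & uc = 0], s1 = 0 /\ s2 = 0 &
      [/\ ka = 0, kb = 0 & kc = 0]].
Proof.
move=> [[vi wja wjb wjc] [sv1 sv2] [ea eb ec] _] H.
(* Varying a single angle row isolates the two multipliers in which it occurs. *)
have [ua0 ka0 ka1] : [/\ ua = 0, ka * v 0 0 = 0 & ka * v 0 1 = 0].
  apply: (unit_row_cancel wja ea) => d.
  by rewrite -[RHS](H 0 d 0 0) !mxE; ring.
have [ub0 kb0 kb1] : [/\ ub = 0, kb * v 0 2 = 0 & kb * v 0 3 = 0].
  apply: (unit_row_cancel wjb eb) => d.
  by rewrite -[RHS](H 0 0 d 0) !mxE; ring.
have [uc0 kc0 kc1] : [/\ uc = 0, kc * v 0 4 = 0 & kc * v 0 5 = 0].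
  apply: (unit_row_cancel wjc ec) => d.
  by rewrite -[RHS](H 0 0 0 d) !mxE; ring.
(* The coefficient of [dv 0 j] in the relation. *)
have Hv j : u * (i == j)%:R + s1 * ((0 == j)%:R + (2 == j)%:R + (4 == j)%:R) +
    s2 * ((1 == j)%:R + (3 == j)%:R + (5 == j)%:R) +
    ka * (wa 0 0 * (1 == j)%:R - wa 0 1 * (0 == j)%:R) +
    kb * (wb 0 0 * (3 == j)%:R - wb 0 1 * (2 == j)%:R) +
    kc * (wc 0 0 * (5 == j)%:R - wc 0 1 * (4 == j)%:R) = 0.
  by rewrite -[RHS](H (delta_mx 0 j) 0 0 0) !mxE /=; ring.
have H0 := Hv 0; have H1 := Hv 1; have H2 := Hv 2.
have H3 := Hv 3; have H4 := Hv 4; have H5 := Hv 5.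
have : i \in [:: 0; 1; 2; 3; 4; 5].
  by case: i {vi Hv H H0 H1 H2 H3 H4 H5} => -[|[|[|[|[|[|//]]]]]].
rewrite !inE => iE {Hv H}.
case/or4P: iE vi H0 H1 H2 H3 H4 H5 =>
  [/eqP->|/eqP->|/eqP->|/or3P[]/eqP->] /= vi H0 H1 H2 H3 H4 H5.
(* Here [i] lies on the edge [a], so [ka = 0]; columns 2 to 5 make [(s1, s2)] normal to both [wb]
   and [wc], and column [i] then gives [u = 0]. *)
- have kaE : ka = 0 by rewrite -[RHS]ka0 vi mulr1.
  rewrite kaE in H0 H1 H2 H3 H4 H5.
  have [kbE kcE s1E s2E] : [/\ kb = 0, kc = 0, s1 = 0 & s2 = 0].
    apply: (@parallel_cancel kb kc s1 s2
    (v 0 0) (v 0 1) (v 0 2) (v 0 3) (v 0 4) (v 0 5) wb wc jb jc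
    (And4 kb0 kb1 kc0 kc1)) => //;
    by [left; rewrite vi oner_eq0|lra|split; lra].
  by rewrite kbE kcE s1E s2E in H0; split=> //; lra.
- have kaE : ka = 0 by rewrite -[RHS]ka1 vi mulr1.
  rewrite kaE in H0 H1 H2 H3 H4 H5.
  have [kbE kcE s1E s2E] : [/\ kb = 0, kc = 0, s1 = 0 & s2 = 0].
    apply: (@parallel_cancel kb kc s1 s2
    (v 0 0) (v 0 1) (v 0 2) (v 0 3) (v 0 4) (v 0 5) wb wc jb jc
    (And4 kb0 kb1 kc0 kc1)) => //;
    by [right; rewrite vi oner_eq0|lra|split; lra].
  by rewrite kbE kcE s1E s2E in H1; split=> //; lra.
- have kbE : kb = 0 by rewrite -[RHS]kb0 vi mulr1.
  rewrite kbE in H0 H1 H2 H3 H4 H5.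
  have [kaE kcE s1E s2E] : [/\ ka = 0, kc = 0, s1 = 0 & s2 = 0].
    apply: (@parallel_cancel ka kc s1 s2
    (v 0 2) (v 0 3) (v 0 0) (v 0 1) (v 0 4) (v 0 5) wa wc ja jc
    (And4 ka0 ka1 kc0 kc1)) => //;
    by [left; rewrite vi oner_eq0|lra|split; lra].
  by rewrite kaE kcE s1E s2E in H2; split=> //; lra.
- have kbE : kb = 0 by rewrite -[RHS]kb1 vi mulr1.
  rewrite kbE in H0 H1 H2 H3 H4 H5.
  have [kaE kcE s1E s2E] : [/\ ka = 0, kc = 0, s1 = 0 & s2 = 0].
    apply: (@parallel_cancel ka kc s1 s2
    (v 0 2) (v 0 3) (v 0 0) (v 0 1) (v 0 4) (v 0 5) wa wc ja jc
    (And4 ka0 ka1 kc0 kc1)) => //;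
    by [right; rewrite vi oner_eq0|lra|split; lra].
  by rewrite kaE kcE s1E s2E in H3; split=> //; lra.
- have kcE : kc = 0 by rewrite -[RHS]kc0 vi mulr1.
  rewrite kcE in H0 H1 H2 H3 H4 H5.
  have [kaE kbE s1E s2E] : [/\ ka = 0, kb = 0, s1 = 0 & s2 = 0].
    apply: (@parallel_cancel ka kb s1 s2
    (v 0 4) (v 0 5) (v 0 0) (v 0 1) (v 0 2) (v 0 3) wa wb ja jb
    (And4 ka0 ka1 kb0 kb1)) => //;
    by [left; rewrite vi oner_eq0|lra|split; lra].
  by rewrite kaE kbE s1E s2E in H4; split=> //; lra.
- have kcE : kc = 0 by rewrite -[RHS]kc1 vi mulr1.
  rewrite kcE in H0 H1 H2 H3 H4 H5.
  have [kaE kbE s1E s2E] : [/\ ka = 0, kb = 0, s1 = 0 & s2 = 0].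
    apply: (@parallel_cancel ka kb s1 s2
    (v 0 4) (v 0 5) (v 0 0) (v 0 1) (v 0 2) (v 0 3) wa wb ja jb
    (And4 ka0 ka1 kb0 kb1)) => //;
    by [right; rewrite vi oner_eq0|lra|split; lra].
  by rewrite kaE kbE s1E s2E in H5; split=> //; lra.
Qed.

Definition base_derivs i ja jb jc (v : 'rV[R]_6) (wa wb wc : 'rV[R]_2)
    (dv : 'rV[R]_6) (da db dc : 'rV[R]_2) : seq R :=
  [:: dv 0 i; da 0 ja; db 0 jb; dc 0 jc;
      dv 0 0 + dv 0 2 + dv 0 4; dv 0 1 + dv 0 3 + dv 0 5;
      da 0 0 * v 0 1 + wa 0 0 * dv 0 1 - (da 0 1 * v 0 0 + wa 0 1 * dv 0 0);
      db 0 0 * v 0 3 + wb 0 0 * dv 0 3 - (db 0 1 * v 0 2 + wb 0 1 * dv 0 2);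
      dc 0 0 * v 0 5 + wc 0 0 * dv 0 5 - (dc 0 1 * v 0 4 + wc 0 1 * dv 0 4)].

Lemma dirderiv_base_polys i ja jb jc b x v wa wb wc l b' dx dv da db dc :
  dirderiv (base_polys i ja jb jc)`_l (chart_pt b x v wa wb wc)
    (chart_pt b' dx dv da db dc) =
  (base_derivs i ja jb jc v wa wb wc dv da db dc)`_l.
Proof.
have [_ yv ya yb yc] := chart_ptE b x v wa wb wc.
have [_ zv za zb zc] := chart_ptE b' dx dv da db dc.
have dE := (dirderivB, dirderivD, dirderivM, dirderivX, dirderivC, pevalX).
case: l => [|[|[|[|[|[|[|[|[|l]]]]]]]]] /=; last first.
  by rewrite !nth_nil -[X in dirderiv X]mpolyC0 dirderivC.
all: rewrite ?/wedge_poly !dE.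
all: by rewrite ?(zv, za, zb, zc) ?(yv, ya, yb, yc) ?subr0.
Qed.

Lemma nonsingular_affine_part i ja jb jc :
  nonsingular 6 (affine_part (triangles R) i ja jb jc).
Proof.
have VE y : affine_part (triangles R) i ja jb jc y <->
    forall k, peval (chart_polys i ja jb jc k) y = 0.
  have [b [x [v [wa [wb [wc ->]]]]]] := chart_ptP y.
  by rewrite affine_partE chart_polysE.
split=> //.
  exists (range (chart_polys i ja jb jc)); apply/seteqP; split=> y /=.
    by move=> /VE H _ [k _ <-].
  by move=> H; apply/VE => k; apply: H; exists k.
(* The same equations cut out the whole chart, so [h = 1] serves at every point. *)
move=> y /VE Vy; exists (chart_polys i ja jb jc), (mpolyC _ 1); split.
- by rewrite pevalC; apply/eqP; exact: oner_neq0.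
- by move=> z _; exact: VE.
apply: (@rank_jacobian _ _ (9 + 5) (chart_polys i ja jb jc)) => u uJ.
have [b [x [v [wa [wb [wc yE]]]]]] := chart_ptP y.
move: Vy; rewrite yE => /chart_polysE eqs.
have [yx yv ya yb yc] := chart_ptE b x v wa wb wc.
have H dx dv da db dc : \sum_(l < 9) u (lshift 5 l) *
      dirderiv (base_polys i ja jb jc)`_l y (chart_pt 0 dx dv da db dc) +
    \sum_(j < 5) u (rshift 9 j) * (dx 0 (lift i j) -
      (dx 0 i * v 0 (lift i j) + x 0 i * dv 0 (lift i j))) = 0.
  rewrite -[RHS](uJ (chart_pt 0 dx dv da db dc)) big_split_ord /=.
  have [zx zv za zb zc] := chart_ptE 0 dx dv da db dc.
  congr (_ + _); apply: eq_bigr => j _; first by rewrite chart_polys_l.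
  rewrite chart_polys_r /ratio_poly dirderivB dirderivM !dirderivX !pevalX yE.
  by rewrite !zx !zv yx yv.
(* Among all the equations, only the ratio of index [j] involves the coordinate [lift i j] of
   [x]. *)
have ur j : u (rshift 9 j) = 0.
  have := H (delta_mx 0 (lift i j)) 0 0 0 0.
  rewrite big1 ?add0r; last first.
    move=> l _; rewrite yE dirderiv_base_polys; case: l => -[|[|[|[|[|[|[|[|[|//]]]]]]]]] ? /=;
    by rewrite !mxE !(mulr0, mul0r, addr0, subr0).
  rewrite (bigD1 j)//= big1 ?addr0; last first.
    move=> k kj; rewrite !mxE (inj_eq lift_inj) (negPf kj) (negPf (neq_lift _ _)).
    by rewrite /= !(mulr0, mul0r, addr0, subr0).
  by rewrite !mxE !eqxx (negPf (neq_lift _ _)) /= !(mulr0, mul0r, addr0, subr0, mulr1).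
(* Indexing by natural numbers lets the sum over ['I_9] unfold into the nine explicit terms of
   [chart_cancel]. *)
pose U (l : nat) := u (lshift 5 (inord l)).
have [u0 [u1 u2 u3] [u4 u5] [u6 u7 u8]] :
    [/\ U 0%N = 0, [/\ U 1%N = 0, U 2%N = 0 & U 3%N = 0], U 4%N = 0 /\ U 5%N = 0 &
        [/\ U 6%N = 0, U 7%N = 0 & U 8%N = 0]].
  apply: (chart_cancel eqs) => dv da db dc.
  rewrite -[RHS](H 0 dv da db dc) [X in _ = _ + X]big1 => [|j _]; last by rewrite ur mul0r.
  rewrite (eq_bigr (fun l : 'I_9 =>
      U l * (base_derivs i ja jb jc v wa wb wc dv da db dc)`_l)).
    by rewrite !big_ord_recl big_ord0 /= !addr0 !addrA.
  by move=> l _; rewrite yE dirderiv_base_polys /U inord_val.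
have ul (l : 'I_9) : U l = 0 -> u (lshift 5 l) = 0 by rewrite /U inord_val.
move=> k; case: (split_ordP k) => [l ->|j ->]; last exact: ur.
by apply: ul; case: l => -[|[|[|[|[|[|[|[|[|//]]]]]]]]] ? /=.
Qed.

End AffineCharts.

Theorem theorem4p1p1 (R : realType) :
  BlHtilde R = triangles R /\ smooth_R_variety (triangles R).
Proof.
(* The dimension 6 is 2 for [B_0] plus 4 for [X R]. *)
split; last by exists 6 => i ja jb jc; exact: nonsingular_affine_part.
by apply/seteqP; split; [exact: BlHtilde_sub_triangles|exact: triangles_sub_BlHtilde].
Qed.
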